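(* Let $M$ be a closed Riemannian manifold and let $f\colon M\to M$ be a $C^1$-diffeomorphism. If there is an uncountable hyperbolic set $\Lambda$ for $f$, then $f$ is Bohr chaotic.
   Context: A closed manifold is a compact manifold without boundary; $M$ is regarded as a compact metric space with a metric inducing its topology (e.g. the Riemannian distance). Hyperbolic set has its standard meaning: a compact set $\Lambda\subset M$ with $f(\Lambda)=\Lambda$ such that there are a $Df$-invariant splitting $T_xM=E^s_x\oplus E^u_x$, $x\in\Lambda$, and constants $c>0$, $0<\lambda<1$ with $\|Df^n_x v\|\le c\lambda^n\|v\|$ for $v\in E^s_x$ and $\|Df^{-n}_x v\|\le c\lambda^n\|v\|$ for $v\in E^u_x$, for all $x\in\Lambda$ and $n\ge0$. Bohr chaos: for a compact metric space $X$ let $C(X)$ be the set of continuous real-valued functions on $X$. A continuous map $f\colon X\to X$ is Bohr chaotic if for every bounded sequence $(a_i)_{i\ge0}$ of real numbers with $\limsup_{n\to\infty}\frac1n\sum_{i=0}^{n-1}|a_i|>0$ there are $x\in X$ and $\phi\in C(X)$ with $\limsup_{n\to\infty}\frac1n\left|\sum_{i=0}^{n-1}a_i\phi(f^i(x))\right|>0$. *)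

(* Defs.v *)
From HB Require Import structures.
From mathcomp Require Import all_boot all_order all_algebra.
From mathcomp Require Import all_classical all_reals all_analysis.
Import Order.TTheory GRing.Theory Num.Theory.
Import numFieldNormedType.Exports.

Set Implicit Arguments.
Unset Strict Implicit.
Unset Printing Implicit Defensive.

Local Open Scope classical_set_scope.
Local Open Scope ring_scope.

(* Meant for open [U] in finite dimension: there, [f] is C^(k+1) iff it is
   differentiable and each [x |-> Df_x v] is C^k. *)
Fixpoint Ck_on (R : realType) (V W : normedModType R) (k : nat) (U : set V)
    (f : V -> W) {struct k} : Prop :=
  match k with
  | 0%N => forall x, U x -> {for x, continuous f}
  | k'.+1 => (forall x, U x -> differentiable f x) /\
             (forall v : V, Ck_on k' U (fun x => 'd f x v))
  end.

Definition smooth_on (R : realType) (V W : normedModType R) (U : set V)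
    (f : V -> W) : Prop :=
  forall k, Ck_on k U f.

(* A homeomorphism between an open subset of [M] and an open subset of R^n; the
   values of the two maps outside [chart_dom] and [chart_cod] are irrelevant. *)
Record chart (R : realType) (n : nat) (M : topologicalType) := Chart {
  chart_dom : set M;
  chart_cod : set 'rV[R]_n;
  chart_fun : M -> 'rV[R]_n;
  chart_inv : 'rV[R]_n -> M;
  chart_dom_open : open chart_dom;
  chart_cod_open : open chart_cod;
  chart_fun_cod : forall x, chart_dom x -> chart_cod (chart_fun x);
  chart_inv_dom : forall y, chart_cod y -> chart_dom (chart_inv y);
  chart_funK : forall x, chart_dom x -> chart_inv (chart_fun x) = x;
  chart_invK : forall y, chart_cod y -> chart_fun (chart_inv y) = y;
  chart_fun_cont : forall x, chart_dom x -> {for x, continuous chart_fun};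
  chart_inv_cont : forall y, chart_cod y -> {for y, continuous chart_inv}
}.

(* A C^oo structure without boundary on [M], of dimension [n]. The atlas need
   not be maximal. Each point x comes with a preferred chart of the atlas, which
   identifies T_x M with R^n: everywhere below, a vector of R^n stands for the
   tangent vector at x having these coordinates in the chart [chart_at S x]. *)
Record smooth_structure (R : realType) (n : nat) (M : topologicalType) :=
  SmoothStructure {
  atlas : set (chart R n M);
  chart_at : M -> chart R n M;
  chart_at_atlas : forall x, atlas (chart_at x);
  chart_at_dom : forall x, chart_dom (chart_at x) x;
  atlas_compat : forall e e', atlas e -> atlas e' ->
    smooth_on (chart_cod e `&` [set y | chart_dom e' (chart_inv e y)])
              (chart_fun e' \o chart_inv e)
}.

(* Df_x : T_x M -> T_(f x) M, read in the preferred charts at x and at f x. *)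
Definition tangent_map (R : realType) (n : nat) (M : topologicalType)
    (S : smooth_structure R n M) (f : M -> M) (x : M) :
    {linear 'rV[R]_n -> 'rV[R]_n} :=
  'd (chart_fun (chart_at S (f x)) \o f \o chart_inv (chart_at S x))
     (chart_fun (chart_at S x) x).

(* The isomorphism R^n -> T_p M, p := chart_inv e y, given by the coordinates
   in the chart [e]. *)
Definition from_chart (R : realType) (n : nat) (M : topologicalType)
    (S : smooth_structure R n M) (e : chart R n M) (y : 'rV[R]_n) :
    {linear 'rV[R]_n -> 'rV[R]_n} :=
  'd (chart_fun (chart_at S (chart_inv e y)) \o chart_inv e) y.

(* [x |-> chart_at S x] is in general not even continuous, so that smoothness
   is required of the coefficients of the metric in each chart of the atlas. *)
Record riemannian_metric (R : realType) (n : nat) (M : topologicalType)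
    (S : smooth_structure R n M) := RiemannianMetric {
  rdot : M -> 'rV[R]_n -> 'rV[R]_n -> R;
  rdot_linear : forall (x : M) (a : R) (u v w : 'rV[R]_n),
    rdot x (a *: u + v) w = a * rdot x u w + rdot x v w;
  rdot_sym : forall (x : M) (u v : 'rV[R]_n),
    rdot x u v = rdot x v u;
  rdot_pos : forall (x : M) (u : 'rV[R]_n), u != 0 -> 0 < rdot x u u;
  rdot_smooth : forall e, atlas S e -> forall u v : 'rV[R]_n,
    smooth_on (chart_cod e)
      (fun y => rdot (chart_inv e y) (from_chart S e y u) (from_chart S e y v))
}.

Definition rnorm (R : realType) (n : nat) (M : topologicalType)
    (S : smooth_structure R n M) (g : riemannian_metric S) (x : M)
    (v : 'rV[R]_n) : R :=
  Num.sqrt (rdot g x v v).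

Definition C1_map (R : realType) (n : nat) (M : topologicalType)
    (S : smooth_structure R n M) (f : M -> M) : Prop :=
  continuous f /\
  forall e e', atlas S e -> atlas S e' ->
    Ck_on 1 (chart_cod e `&` [set y | chart_dom e' (f (chart_inv e y))])
          (chart_fun e' \o f \o chart_inv e).

Record C1_diffeo (R : realType) (n : nat) (M : topologicalType)
    (S : smooth_structure R n M) := C1Diffeo {
  diffeo_fun :> M -> M;
  diffeo_inv : M -> M;
  diffeo_funK : cancel diffeo_fun diffeo_inv;
  diffeo_invK : cancel diffeo_inv diffeo_fun;
  diffeo_fun_C1 : C1_map S diffeo_fun;
  diffeo_inv_C1 : C1_map S diffeo_inv
}.

Definition hyperbolic_set (R : realType) (n : nat) (M : topologicalType)
    (S : smooth_structure R n M) (g : riemannian_metric S) (f : C1_diffeo S)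
    (Lambda : set M) : Prop :=
  [/\ compact Lambda,
      f @` Lambda = Lambda &
      exists (Es Eu : M -> {vspace 'rV[R]_n}) (c lambda : R),
        [/\ 0 < c,
            0 < lambda < 1 &
            forall x, Lambda x ->
              [/\ (Es x + Eu x)%VS = fullv /\ (Es x :&: Eu x)%VS = 0%VS,
                  (linfun (tangent_map S f x) @: Es x)%VS = Es (f x),
                  (linfun (tangent_map S f x) @: Eu x)%VS = Eu (f x),
                  (forall (k : nat) (v : 'rV[R]_n), v \in Es x ->
                     rnorm g (iter k f x) (tangent_map S (iter k f) x v)
                     <= c * lambda ^+ k * rnorm g x v) &
                  (forall (k : nat) (v : 'rV[R]_n), v \in Eu x ->
                     rnorm g (iter k (diffeo_inv f) x)
                       (tangent_map S (iter k (diffeo_inv f)) x v)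
                     <= c * lambda ^+ k * rnorm g x v)]]].

(* The averages are indexed by n >= 0; the term n = 0 is 0 and does not affect
   the limsup. *)
Definition bohr_chaotic (R : realType) (X : metricType R) (f : X -> X) : Prop :=
  forall a : nat -> R,
    (exists C : R, forall i, `|a i| <= C) ->
    (0 < limn_esup (fun n => (n%:R^-1 * \sum_(i < n) `|a i|)%:E))%E ->
    exists (x : X) (phi : X -> R),
      continuous phi /\
      (0 < limn_esup
             (fun n => (n%:R^-1 * `|\sum_(i < n) a i * phi (iter i f x)|)%:E))%E.

(* Main.v *)
Require Import Defs.
From HB Require Import structures.
From mathcomp Require Import all_boot all_order all_algebra.
From mathcomp Require Import all_classical all_reals all_analysis.
From mathcomp Require Import zify ring lra.
Import Order.TTheory GRing.Theory Num.Theory.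
Import numFieldNormedType.Exports.
Local Open Scope classical_set_scope.
Local Open Scope ring_scope.

(** A power [h] of [f] has the shadowing property on [Lambda], and its orbits
    near [Lambda] are uniformly expansive: in charts, an orbit close to a
    pseudo-orbit is a fixed point of a 1/2-contraction which pushes stable
    components forward and pulls unstable ones back.

    Code the points of [Lambda] by a finite partition of small diameter. If any
    two closed loops of equal length at the same code stayed close together,
    then by expansivity a point of [Lambda] would be determined by a finite part
    of its itinerary, and [Lambda] would be countable. So there are two loops of
    equal length at the same code which separate at some time, and shadowing
    realises every bi-infinite concatenation of them.

    Let [z] shadow the walk which follows the first loop except for one passage
    along the second one. It is homoclinic to the periodic point shadowing the
    first loop, hence isolated in its [f]-orbit closure. An orbit which shadows
    sparse passages along the second loop, at prescribed times in [B Z], visits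
    a small neighbourhood of [z] exactly at these times. Given [(a_i)], some
    residue class mod [B] and some sign carry a positive part of the averages of
    [|a_i|]; prescribing visits at these times, a bump function at [z] sees no
    cancellation. *)

Set Implicit Arguments.
Unset Strict Implicit.
Unset Printing Implicit Defensive.

(** * Markers *)

(** Shadowing orbits may leave [Lambda], so the coding only produces orbits of [M] near walks in
    [Lambda]. This is why expansivity compares two arbitrary full orbits near one pseudo-orbit, in a
    finite-window form which also makes the coding continuous.

    The definition of a hyperbolic set gives neither continuity of the splitting nor a bound on its
    angle, and the preferred charts jump from point to point. All estimates are therefore made in a
    finite atlas with closed pieces, and boundedness and uniform continuity of the projections are
    extracted from the contraction estimates. The power [h = iter N f] absorbs the multiplicative
    constant, the norms of the projections and the distortion of the charts, so that one step
    contracts by a definite 1/8.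

    The price of the power is paid at the end: a bump function must also vanish at the intermediate
    iterates of [f], so [z] has to be isolated along full orbits of [f]. The spacing [B] is then
    taken so large that a window meets at most one prescribed passage. *)

Lemma limn_esup_gt0P (R : realType) (u : nat -> R) :
  (0 < limn_esup (fun n => (u n)%:E))%E <->
  exists2 c : R, 0 < c & forall N, exists2 n, (N <= n)%N & c <= u n.
Proof.
rewrite limn_esup_lim; have /cvg_lim -> // := @cvg_esups_inf R (fun n => (u n)%:E).
split.
- set l := ereal_inf _ => l0.
  have [c c0 cl] : exists2 c : R, 0 < c & (c%:E < l)%E.
    case: l l0 => [r||//]; rewrite ?lte_fin => r0; last by exists 1; rewrite ?ltry.
    by exists (r / 2); rewrite ?lte_fin ?ltr_pdivrMr ?divr_gt0 // mulr2n mulrDr mulr1 ltrDl.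
  exists c => // N.
  have /ereal_sup_gt[_ [n /= Nn <-]] : (c%:E < esups (fun n => (u n)%:E) N)%E.
    by apply: (lt_le_trans cl); apply: ereal_inf_lbound; exists N.
  by rewrite lte_fin => /ltW ?; exists n.
- case=> c c0 H; apply: (@lt_le_trans _ _ c%:E); first by rewrite lte_fin.
  apply: le_ereal_inf_tmp => _ [N _ <-] /=.
  have [n Nn cn] := H N; apply: (@le_trans _ _ (u n)%:E); first by rewrite lee_fin.
  by apply: ereal_sup_ubound; exists n.
Qed.

Lemma infinitely_often_pigeonhole (T : finType) (P : T -> nat -> Prop) :
  (forall N, exists t, exists2 n, (N <= n)%N & P t n) ->
  exists t, forall N, exists2 n, (N <= n)%N & P t n.
Proof.
move=> H; apply: contrapT => /forallNP nH.
have /choice[b bP] : forall t, exists N, forall n, (N <= n)%N -> ~ P t n.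
  move=> t; have /existsNP[N nN] := nH t; exists N => n Nn Ptn.
  by apply: nN; exists n.
have [t [n Nn]] := H (\max_t b t); apply: bP.
by apply: leq_trans Nn; exact: leq_bigmax.
Qed.

Lemma near_mdist_lt (R : realType) (X : metricType R) (x : X) (e : R) :
  0 < e -> \forall y \near x, mdist x y < e.
Proof. by move=> e0; have := nbhsx_ballx x e e0; rewrite ballEmdist. Qed.

Lemma nbhs_mdist_ltP (R : realType) (X : metricType R) (x : X) (A : set X) :
  nbhs x A <-> exists2 e : R, 0 < e & forall y, mdist x y < e -> A y.
Proof.
split=> [/nbhs_ballP[e /= e0 eA]|[e e0 eA]].
  by exists e => // y xy; apply: eA; rewrite ballEmdist.
exact: filterS eA (near_mdist_lt x e0).
Qed.

(** The gap between [eta] and [2 eta] leaves room for a bump function which only takes the values 0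
    and 1 along the orbit. The weighted sum is then, up to sign, exactly the sum of [|a i|] over one
    of the [2 B] classes given by residue and sign, one of which keeps a share [c / (2 B)] of the
    averages infinitely often. *)
Lemma bohr_chaotic_of_markers (R : realType) (X : metricType R) (f : X -> X)
    (B : nat) (z : X) (eta : R) : (0 < B)%N -> 0 < eta ->
  (forall s : nat -> bool, exists x, forall i,
     if (B %| i)%N && s (i %/ B)%N then mdist z (iter i f x) <= eta
     else eta *+ 2 <= mdist z (iter i f x)) ->
  bohr_chaotic f.
Proof.
move=> B0 eta0 marker a _ /limn_esup_gt0P[c c0 ca].
pose cond (q : 'I_B * bool) i :=
  (i %% B == q.1)%N && (if q.2 then 0 <= a i else a i < 0).
pose v q n := n%:R^-1 * \sum_(i < n | cond q i) `|a i|.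
have sumv n : n%:R^-1 * \sum_(i < n) `|a i| = \sum_q v q n.
  rewrite /v -mulr_sumr; congr (_ * _).
  under [RHS]eq_bigr do rewrite big_mkcond.
  rewrite exchange_big; apply: eq_bigr => i _ /=.
  pose q0 : 'I_B * bool := (Ordinal (ltn_pmod i B0), 0 <= a i).
  rewrite (bigD1 q0)//= big1 ?addr0 /cond /= ?eqxx /=.
    by rewrite ltNge; case: (0 <= a i).
  move=> [r b] /=; rewrite -pair_eqE /pair_eq/= negb_and.
  case: ifP => // /andP[/eqP ri]; rewrite -val_eqE /= ri eqxx /=.
  by case: b => [->|]//; rewrite ltNge => /negbTE ->.
have [q qP] : exists q, forall N, exists2 n, (N <= n)%N &
    c / #|{: 'I_B * bool}|%:R <= v q n.
  apply: infinitely_often_pigeonhole => N; have [n Nn] := ca N.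
  rewrite sumv => cn; apply: contrapT => /forallNP nv.
  move: cn; apply/negP; rewrite -ltNge.
  have card0 : (0 < #|{: 'I_B * bool}|)%N by rewrite card_prod card_ord card_bool muln_gt0 B0.
  have -> : c = \sum_(q : 'I_B * bool) c / #|{: 'I_B * bool}|%:R.
    by rewrite sumr_const -[RHS]mulr_natr divfK// pnatr_eq0 -lt0n.
  have lt q : v q n < c / #|{: 'I_B * bool}|%:R.
    by rewrite ltNge; apply/negP => H; apply: (nv q); exists n.
  apply: ltr_sum => //; apply/hasP; exists (Ordinal B0, true) => //.
(* Index [k] stands for time [k B] of the marker orbit. With the start moved by [B - q.1], this is
   time [q.1 + (k - 1) B]; index 0 lies before the new start and is set to [false]. *)
pose s k := (0 < k)%N && (let i := (q.1 + k.-1 * B)%N in if q.2 then 0 <= a i else a i < 0).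
have [x xP] := marker s.
pose phi y := Num.max 0 (Num.min 1 (2 - mdist z y / eta)).
have phi1 y : mdist z y <= eta -> phi y = 1.
  move=> yz; rewrite /phi min_l ?max_r//.
  by rewrite lerBrDl -lerBrDr ler_pdivrMr//; lra.
have phi0 y : eta *+ 2 <= mdist z y -> phi y = 0.
  move=> yz; rewrite /phi max_l//; rewrite ge_min; apply/orP; right.
  by rewrite subr_le0 ler_pdivlMr// mulrC mulr_natr.
exists (iter (B - q.1) f x), phi; split.
  move=> y; apply: (@continuous_max _ _ (fun=> 0) (fun y => Num.min 1 (2 - mdist z y / eta))).
    exact: cvg_cst.
  apply: (@continuous_min _ _ (fun=> 1) (fun y => 2 - mdist z y / eta)).
    exact: cvg_cst.
  apply/cvgrPdist_le => e e0.
  apply: filterS (near_mdist_lt y (mulr_gt0 e0 eta0)) => t yt.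
  have := metric_triangle z t y; have := metric_triangle z y t.
  have -> : 2 - mdist z y / eta - (2 - mdist z t / eta) =
      (mdist z t - mdist z y) / eta by ring.
  rewrite (metric_sym t y) normrM normfV (gtr0_norm eta0).
  by rewrite ler_pdivrMr// ler_norml => ? ?; lra.
have phiE i : a i * phi (iter i f (iter (B - q.1) f x)) =
    if cond q i then (-1) ^+ (~~ q.2) * `|a i| else 0.
  rewrite -iterD; have := xP (i + (B - q.1))%N.
  have qB := ltn_ord q.1.
  have [iq|niq] := eqVneq (i %% B)%N q.1.
    have iE := divn_eq i B; rewrite iq in iE.
    have jE : (i + (B - q.1) = (i %/ B).+1 * B)%N by rewrite {1}iE mulSn; lia.
    have -> : (B %| i + (B - q.1))%N by rewrite jE dvdn_mull.
    rewrite jE mulnK// /s /= addnC -iE /cond iq eqxx /=.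
    case: (q.2) => /=.
      case: ifP => ai; [move/phi1->|move/phi0->]; rewrite ?mulr0 ?mulr1 ?mul1r//.
      by rewrite ger0_norm.
    case: ifP => ai; [move/phi1->|move/phi0->]; rewrite ?mulr0 ?mulr1 ?mul1r//.
    by rewrite ltr0_norm// mulN1r opprK.
  have -> : (B %| i + (B - q.1))%N = false.
    apply/negbTE/negP => /dvdnP[k kE]; move/negP: niq; apply; apply/eqP.
    have k0 : (0 < k)%N by case: k kE => //; lia.
    have -> : i = (k.-1 * B + q.1)%N.
      have Bk : (B <= k * B)%N by rewrite leq_pmull.
      by rewrite -subn1 mulnBl mul1n; move: (k * B)%N kE Bk => m; lia.
    by rewrite modnMDl modn_small.
  by rewrite /= /cond (negbTE niq) => /phi0 ->; rewrite mulr0.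
apply/limn_esup_gt0P; exists (c / #|{: 'I_B * bool}|%:R).
  by rewrite divr_gt0// ltr0n card_prod card_ord card_bool muln_gt0 B0.
move=> N; have [n Nn vn] := qP N; exists n => //; apply: (le_trans vn).
rewrite /v ler_wpM2l ?invr_ge0//.
under [X in `|X|]eq_bigr do rewrite phiE.
rewrite -big_mkcond -mulr_sumr normrM normrX normrN1 expr1n mul1r.
exact: ler_norm.
Qed.

(** * Separated loops in an uncountable expansive set *)

Definition full_orbit (X : Type) (h : X -> X) (y : int -> X) :=
  forall i, y (i + 1) = h (y i).

Definition orbit_through (X : Type) (h hinv : X -> X) (x : X) (i : int) : X :=
  match i with Posz k => iter k h x | Negz k => iter k.+1 hinv x end.

Lemma orbit_through_full (X : Type) (h hinv : X -> X) (x : X) :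
  cancel hinv h -> full_orbit h (orbit_through h hinv x).
Proof.
move=> hK [k|[|k]] /=; first by rewrite addn1.
  by rewrite hK.
by rewrite subn1 /= hK.
Qed.

Lemma full_orbitD (X : Type) (h : X -> X) (y : int -> X) : full_orbit h y ->
  forall (k : nat) i, y (i + k%:Z) = iter k h (y i).
Proof.
move=> yo; elim=> [|k IH] i; first by rewrite addr0.
by rewrite iterS -IH -yo; congr y; lia.
Qed.

Lemma full_orbit_shift (X : Type) (h : X -> X) (y : int -> X) (c : int) :
  full_orbit h y -> full_orbit h (fun i => y (i + c)).
Proof. by move=> yo i /=; rewrite -yo addrAC. Qed.

Lemma full_orbit_inj (X : Type) (h : X -> X) (y y' : int -> X) (j : int) :
  injective h -> full_orbit h y -> full_orbit h y' -> y j = y' j -> y =1 y'.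
Proof.
move=> hI yo yo' yj i; have [ji|/ltW ij] := lerP j i.
  have -> : i = j + (`|i - j|%N)%:Z by lia.
  by rewrite (full_orbitD yo) (full_orbitD yo') yj.
have jE : j = i + (`|j - i|%N)%:Z by lia.
move: yj; rewrite jE (full_orbitD yo) (full_orbitD yo').
by elim: `|j - i|%N => //= k IH /hI.
Qed.

Lemma compact_finite_subcover (R : realType) (M : metricType R) (r : M -> R) :
  compact [set: M] -> (forall x, 0 < r x) ->
  exists s : seq M, forall x, exists2 z, z \in s & mdist z x < r z.
Proof.
move=> /compact_near_coveringP cM r0.
pose F := filter_from setT (fun s0 : seq M => [set s : seq M | {subset s0 <= s}]).
have FF : Filter F.
  apply: filter_from_filter; first by exists [::].
  move=> s1 s2 _ _; exists (s1 ++ s2) => // s /= ss.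
  by split=> x xs; apply: ss; rewrite mem_cat xs ?orbT.
have [x _|s0 _ /(_ s0 (fun=> id)) cP] :=
    cM _ F (fun s x => exists2 z, z \in s & mdist z x < r z) FF; last first.
  by exists s0 => x; exact: cP.
exists ([set y | mdist x y < r x], [set s : seq M | x \in s]).
  split; first exact: near_mdist_lt.
  by exists [:: x] => // s /(_ x) /= ; rewrite mem_head; apply.
by move=> [y s] /= [xy xs]; exists x.
Qed.

Lemma compact_finite_coding (R : realType) (M : metricType R) (d : R) :
  compact [set: M] -> 0 < d ->
  exists m (c : M -> 'I_m), forall x y, c x = c y -> mdist x y < d.
Proof.
move=> cM d0.
have [s sP] := compact_finite_subcover cM (fun=> divr_gt0 d0 (ltr0n R 2)).
pose c x := find (fun z => mdist z x < d / 2) s.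
have cP x : has (fun z => mdist z x < d / 2) s.
  by have [z zs zx] := sP x; apply/hasP; exists z.
have cs x : (c x < size s)%N by rewrite -has_find.
exists (size s), (fun x => Ordinal (cs x)) => x y [cxy].
have := nth_find x (cP y); have := nth_find x (cP x).
rewrite -/(c x) -/(c y) cxy; set z := nth _ _ _ => zx zy.
by have := metric_triangle x z y; rewrite (metric_sym x z); lra.
Qed.

(** Every point has a time whose code recurs arbitrarily late, and one whose code recurs arbitrarily
    early; loops based there are long enough to cover any given time of either tail. If no two loops
    separate, two points with the same base times and the same codes between them stay [e]-close
    forever, so countably many data enumerate [Lambda]. Repeating loops of lengths [a] and [a']
    brings both to the common length [a a'], whence the indices modulo [a] and [a']. *)
Lemma separated_loops (R : realType) (M : metricType R) (h hinv : M -> M)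
    (Lambda : set M) (e d : R) :
  compact [set: M] -> cancel hinv h ->
  (forall x, Lambda x -> Lambda (h x)) ->
  (forall x, Lambda x -> Lambda (hinv x)) ->
  0 < d -> d <= e ->
  (forall y y', full_orbit h y -> full_orbit h y' ->
     (forall i, Lambda (y i) /\ Lambda (y' i) /\ mdist (y i) (y' i) <= e) ->
     y 0 = y' 0) ->
  ~ countable Lambda ->
  exists x x' a a',
    [/\ (0 < a)%N, (0 < a')%N, Lambda x & Lambda x'] /\
    [/\ mdist (iter a h x) x < d, mdist (iter a' h x') x' < d,
        mdist (iter a h x) x' < d & mdist (iter a' h x') x < d] /\
    exists j, (j < a * a')%N /\
      e < mdist (iter (j %% a) h x) (iter (j %% a') h x').
Proof.
move=> cM hK Lh Lhinv d0 de expL ncL.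
have [m [c cP]] := compact_finite_coding cM d0.
apply: contrapT => noloops; apply: ncL.
have loops x x' a a' j : (0 < a)%N -> (0 < a')%N -> Lambda x -> Lambda x' ->
    c (iter a h x) = c x -> c (iter a' h x') = c x' -> c x = c x' ->
    (j < a * a')%N ->
    mdist (iter (j %% a) h x) (iter (j %% a') h x') <= e.
  move=> a0 a'0 Lx Lx' cx cx' cxx' ja.
  rewrite leNgt; apply/negP => ej; apply: noloops.
  exists x, x', a, a'; split=> //; split; last by exists j.
  by split; apply: cP; congruence.
pose o := orbit_through h hinv.
have oL x i : Lambda x -> Lambda (o x i).
  have itL g k y : (forall z, Lambda z -> Lambda (g z)) -> Lambda y -> Lambda (iter k g y).
    by move=> gL; elim: k => //= k IH /IH /gL.
  by case: i => k Lx; rewrite /o /orbit_through; apply: itL.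
have oF x : full_orbit h (o x) by exact: orbit_through_full.
have fwd x : exists b : nat, forall N, exists2 k, (N <= k)%N &
    c (o x (b + k)%:Z) = c (o x b%:Z).
  have [v vP] := @infinitely_often_pigeonhole _ (fun v k => c (o x k%:Z) = v)
    (fun N => ex_intro _ _ (ex_intro2 _ _ N (leqnn N) erefl)).
  have [b _ bv] := vP 0%N; exists b => N.
  have [k Nk kv] := vP (N + b)%N; exists (k - b)%N; first by lia.
  by rewrite bv subnKC //; lia.
have bwd x : exists b : nat, forall N, exists2 k, (N <= k)%N &
    c (o x (- (b + k)%:Z)) = c (o x (- b%:Z)).
  have [v vP] := @infinitely_often_pigeonhole _ (fun v k => c (o x (- k%:Z)) = v)
    (fun N => ex_intro _ _ (ex_intro2 _ _ N (leqnn N) erefl)).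
  have [b _ bv] := vP 0%N; exists b => N.
  have [k Nk kv] := vP (N + b)%N; exists (k - b)%N; first by lia.
  by rewrite bv subnKC //; lia.
have [bf bfP] := choice fwd; have [bb bbP] := choice bwd.
pose data x : nat * nat * seq 'I_m :=
  (bf x, bb x, [seq c (o x (k%:Z - (bb x)%:Z)) | k <- iota 0 (bf x + bb x).+1]).
apply/countable_injP; exists (fun x => pickle (data x)).
move=> x y; rewrite !inE => Lx Ly /(pcan_inj pickleK) dataE.
have bfE : bf x = bf y := congr1 (fun t => t.1.1) dataE.
have bbE : bb x = bb y := congr1 (fun t => t.1.2) dataE.
have codeE : [seq c (o x (k%:Z - (bb y)%:Z)) | k <- iota 0 (bf y + bb y).+1] =
    [seq c (o y (k%:Z - (bb y)%:Z)) | k <- iota 0 (bf y + bb y).+1].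
  by have := congr1 snd dataE; rewrite /data bfE bbE.
have code i : - (bb y)%:Z <= i -> i <= (bf y)%:Z -> c (o x i) = c (o y i).
  move=> bi ib; pose t := absz (i + (bb y)%:Z).
  have tE : t%:Z = i + (bb y)%:Z by rewrite /t; lia.
  have := congr1 (fun s => nth (c x) s t) codeE.
  by rewrite !(nth_map 0%N) ?size_iota ?nth_iota ?add0n ?tE ?addrK//; lia.
suff oE : forall i, mdist (o x i) (o y i) <= e.
  apply: (expL _ _ (oF x) (oF y)) => i.
  by split; [exact: oL|split; [exact: oL|exact: oE]].
move=> i.
have [ib|/ltW bi] := lerP i (- (bb y)%:Z).
- pose j := absz (i + (bb y)%:Z).
  have iE : i = - (bb y + j)%N%:Z by rewrite /j; lia.
  have [A jA cA] := bbP x j.+1; have [A' jA' cA'] := bbP y j.+1.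
  rewrite bbE in cA.
  (* Backward loops end at the base time [- bb y]. A time [j] steps before the end is counted as
     [A A' - j], which is [- j] modulo both lengths. *)
  have mA a b : (0 < b)%N -> (j < a)%N -> ((a * b - j) %% a = if j == 0 then 0 else a - j)%N.
    move=> b0 ja; case: eqP => [->|j0]; first by rewrite subn0 modnMr.
    have -> : (a * b - j = b.-1 * a + (a - j))%N.
      have : (a <= a * b)%N by rewrite leq_pmulr.
      by rewrite mulnC -subn1 mulnBl mul1n; lia.
    by rewrite modnMDl modn_small//; lia.
  have [j0|j0] := eqVneq j 0%N.
    by rewrite (le_trans _ de)// ltW// cP// code//; lia.
  have := @loops (o x (- (bb y + A)%N%:Z)) (o y (- (bb y + A')%N%:Z)) A A' (A * A' - j)%N.
  rewrite mA; [|lia|lia]; rewrite [(A * A')%N]mulnC mA; [|lia|lia].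
  rewrite (negbTE j0) -!(full_orbitD (oF _)).
  have -> : - (bb y + A)%N%:Z + A%:Z = - (bb y)%:Z by lia.
  have -> : - (bb y + A')%N%:Z + A'%:Z = - (bb y)%:Z by lia.
  have -> : - (bb y + A)%N%:Z + (A - j)%N%:Z = i by lia.
  have -> : - (bb y + A')%N%:Z + (A' - j)%N%:Z = i by lia.
  apply; [lia|lia|exact: oL|exact: oL|by []|by []| |].
    by rewrite cA cA' code//; lia.
  have : (A <= A' * A)%N by rewrite leq_pmull; lia.
  lia.
- have [ib|/ltW {}bi] := lerP i (bf y)%:Z.
    by rewrite (le_trans _ de)// ltW// cP// code.
  pose j := `|i - (bf y)%:Z|%N.
  have iE : i = (bf y)%:Z + j%:Z by rewrite /j; lia.
  have [A jA cA] := bfP x j.+1; have [A' jA' cA'] := bfP y j.+1.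
  rewrite bfE in cA.
  have := @loops (o x (bf y)%:Z) (o y (bf y)%:Z) A A' j.
  rewrite !modn_small; [|lia|lia].
  rewrite -!(full_orbitD (oF _)) -iE; apply; [lia|lia|exact: oL|exact: oL|by []|by []| |].
    by rewrite code//; lia.
  have : (A <= A * A')%N by rewrite leq_pmulr; lia.
  lia.
Qed.

(** * Coding of the shift by shadowing orbits *)

Definition pseudo_orbit (R : realType) (M : metricType R) (h : M -> M)
    (Lambda : set M) (d : R) (x : int -> M) :=
  forall i, Lambda (x i) /\ mdist (h (x i)) (x (i + 1)) < d.

Definition shadowing (R : realType) (M : metricType R) (h : M -> M)
    (Lambda : set M) :=
  forall e : R, 0 < e -> exists2 d : R, 0 < d &
    forall x, pseudo_orbit h Lambda d x ->
    exists2 y, full_orbit h y & forall i, mdist (x i) (y i) <= e.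

(** Expansivity on finite windows, uniform in the pseudo-orbit: all [T] together give uniqueness of
    the shadowing orbit, and a single [T] makes a coded orbit depend, up to [eta], on finitely many
    symbols. Neither [y] nor [y'] has to lie in [Lambda]. *)
Definition shadow_expansive (R : realType) (M : metricType R) (h : M -> M)
    (Lambda : set M) (e0 d0 : R) :=
  forall eta : R, 0 < eta -> exists T : nat, forall x y y',
    pseudo_orbit h Lambda d0 x -> full_orbit h y -> full_orbit h y' ->
    (forall i : int, `|i| <= T%:Z ->
       mdist (x i) (y i) <= e0 /\ mdist (x i) (y' i) <= e0) ->
    mdist (y 0) (y' 0) <= eta.

Lemma mdist_small_eq (R : realType) (M : metricType R) (x y : M) :
  (forall e : R, 0 < e -> mdist x y <= e) -> x = y.
Proof.
move=> H; apply: mdist_positivity; apply/eqP; rewrite eq_le mdist_ge0 andbT.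
by apply/ler_addgt0Pl => e e0; rewrite addr0 H.
Qed.

Lemma divz_modz_succ (L : nat) (i : int) : (0 < L)%N ->
  if absz (modz i L) == L.-1 then
    divz (i + 1) L = divz i L + 1 /\ modz (i + 1) L = 0
  else divz (i + 1) L = divz i L /\
    absz (modz (i + 1) L) = (absz (modz i L)).+1.
Proof.
move=> L0; have Lz : L%:Z != 0 by case: L L0.
have Lz0 : 0 < L%:Z by [].
have := divz_eq i L; have := modz_ge0 i Lz; have := ltz_pmod i Lz0.
move: (divz i L) (modz i L) => q r rL r0 ->; case: eqP => rL1.
  have -> : q * L%:Z + r + 1 = (q + 1) * L%:Z + 0 by lia.
  by rewrite divzMDl// modzMDl div0z mod0z addr0.
rewrite -addrA divzMDl// modzMDl divz_small ?modz_small ?addr0; lia.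
Qed.

(* [Y S] shadows the walk which follows the second loop during the time block
   [k L, (k + 1) L) if [S k], and the first one otherwise. *)
Lemma shift_coding (R : realType) (M : metricType R) (h hinv : M -> M)
    (Lambda : set M) (e0 d0 : R) :
  compact [set: M] -> cancel hinv h ->
  (forall x, Lambda x -> Lambda (h x)) ->
  (forall x, Lambda x -> Lambda (hinv x)) ->
  0 < e0 -> 0 < d0 ->
  shadowing h Lambda -> shadow_expansive h Lambda e0 d0 ->
  ~ countable Lambda ->
  exists (L : nat) (Y : (int -> bool) -> int -> M),
    [/\ (0 < L)%N, forall S, full_orbit h (Y S),
      (forall eta : R, 0 < eta -> exists T : nat, forall S S' (c k : int),
        (forall i : int, `|i| <= T%:Z ->
          S (divz (c + i) L) = S' (divz (c + i) L - k)) ->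
        mdist (Y S c) (Y S' (c - k * L%:Z)) <= eta) &
      exists j, Y (fun k => k == 0) j <> Y (fun=> false) j].
Proof.
move=> cM hK Lh Lhinv e00 d00 shad expa ncL.
(* If the orbits coded by the two walks met at time [j], the loops would be within [e0 / 2 + e0 / 2]
   there, against their separation by more than [e0]. *)
have [|d1 d10 shadd] := shad (e0 / 2); first exact: divr_gt0.
pose d := Num.min d1 (Num.min d0 e0).
have dd0 : 0 < d by rewrite !lt_min d10 d00.
have dE : [/\ d <= d1, d <= d0 & d <= e0].
  by split; rewrite !ge_min lexx ?orbT.
have [dd1 dd00 de0] := dE.
have [|x [x' [a [a' [[a0 a'0 Lx Lx'] [[xx x'x' xx' x'x] [j [jL sep]]]]]]]] :=
  @separated_loops R M h hinv Lambda e0 d cM hK Lh Lhinv dd0 de0 _ ncL.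
  move=> y y' yo yo' H; apply: mdist_small_eq => eta eta0.
  have [T TP] := expa _ eta0; apply: (TP y y y') => // [i|i _].
    by have [? _] := H i; split=> //; rewrite yo mdistxx.
  by have [_ [_ ?]] := H i; rewrite mdistxx (ltW e00).
pose L := (a * a')%N; have {}jL : (j < L)%N by [].
have L0 : (0 < L)%N by rewrite muln_gt0 a0.
pose gam (b : bool) t := if b then iter (t %% a') h x' else iter (t %% a) h x.
have itL k y : Lambda y -> Lambda (iter k h y).
  by elim: k => //= k IH /IH /Lh.
have gamL b t : Lambda (gam b t) by rewrite /gam; case: b; exact: itL.
have mod_pred c t : (0 < c)%N -> (c %| t.+1)%N -> (t %% c).+1 = c.
  move=> c0 ct; apply/eqP; rewrite eqn_leq ltn_pmod//= dvdn_leq//.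
  by move: ct; rewrite /dvdn -[t.+1]addn1 -modnDml addn1.
have step c y t : (0 < c)%N -> mdist (iter c h y) y < d ->
    mdist (h (iter (t %% c) h y)) (iter (t.+1 %% c) h y) < d.
  move=> c0 yc; rewrite -iterS modnS; case: ifP => [ct|_]; last by rewrite mdistxx.
  by rewrite mod_pred.
have gam_step b t : mdist (h (gam b t)) (gam b t.+1) < d.
  by rewrite /gam; case: b; exact: step.
(* All four jumps from the end of a loop to the start of a loop are below [d]; hence any sequence of
   blocks is a pseudo-orbit. *)
have gamL0 b b' : mdist (h (gam b L.-1)) (gam b' 0%N) < d.
  have lastL c y : (0 < c)%N -> (c %| L)%N -> h (iter (L.-1 %% c) h y) = iter c h y.
    by move=> c0 cL; rewrite -iterS mod_pred// prednK.
  rewrite /gam !mod0n /=.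
  have aL : (a %| L)%N by exact: dvdn_mulr.
  have a'L : (a' %| L)%N by exact: dvdn_mull.
  by case: b; case: b'; rewrite lastL.
clearbody L; have Lz : L%:Z != 0 by case: (L) L0.
have Lz0 : 0 < L%:Z by [].
pose W (S : int -> bool) (i : int) := gam (S (divz i L)) (absz (modz i L)).
have Wpo S : pseudo_orbit h Lambda d (W S).
  move=> i; split; first exact: gamL.
  rewrite /W; have := divz_modz_succ i L0; case: eqP => [->|_] [-> ->].
    exact: gamL0.
  exact: gam_step.
have WS (S : int -> bool) i k : W S (i + k * L%:Z) = W (fun q => S (q + k)) i.
  by rewrite /W addrC divzMDl// modzMDl [k + _]addrC.
have pseudo_le c c' y : c <= c' -> pseudo_orbit h Lambda c y -> pseudo_orbit h Lambda c' y.
  by move=> cc yP i; have [? /lt_le_trans] := yP i; split; auto.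
have /choice[Y YP] : forall S, exists y, full_orbit h y /\
    forall i, mdist (W S i) (y i) <= e0 / 2.
  move=> S; have [y yo yP] := shadd _ (pseudo_le _ _ _ dd1 (Wpo S)).
  by exists y.
exists L, Y; split=> //; first by move=> S; have [] := YP S.
- move=> eta eta0; have [T TP] := expa _ eta0.
  (* Translated to time 0, both coded orbits shadow the walk of [S] on the window, since [agree]
     identifies the two walks there. *)
  exists T => S S' c k agree.
  have := TP (fun i => W S (i + c)) (fun i => Y S (i + c)) (fun i => Y S' (i + (c - k * L%:Z))).
  rewrite !add0r; apply.
  + by move=> i /=; rewrite addrAC; apply: (pseudo_le _ _ _ dd00 (Wpo S)).
  + by apply: full_orbit_shift; have [] := YP S.
  + by apply: full_orbit_shift; have [] := YP S'.
  move=> i iT; have e02 : e0 / 2 <= e0 by lra.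
  split; first by apply: le_trans e02; have [_] := YP S.
  apply: le_trans e02; have [_ /(_ (i + (c - k * L%:Z)))] := YP S'.
  congr (mdist _ _ <= _).
  by rewrite addrA -mulNr WS /W [i + c]addrC agree.
- exists j%:Z => zp.
  have [_ /(_ j%:Z)] := YP (fun k => k == 0); have [_ /(_ j%:Z)] := YP (fun=> false).
  rewrite zp /W divz_nat modz_nat divn_small// modn_small//=.
  move=> H1 H2; move: sep; apply/negP; rewrite -leNgt.
  have := metric_triangle (iter (j %% a) h x) (Y (fun=> false) j%:Z) (iter (j %% a') h x').
  by rewrite (metric_sym (Y _ _)); lra.
Qed.

(** * A homoclinic marker *)

Lemma compact_uniform (R : realType) (M : topologicalType) (Q : M -> R -> Prop) :
  compact [set: M] ->
  (forall x : M, \forall y \near x & s \near (0 : R)^'+, Q y s) ->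
  \forall s \near (0 : R)^'+, forall y, Q y s.
Proof.
move=> /compact_near_coveringP cM H.
have Qs : \forall s \near (0 : R)^'+, [set: M] `<=` Q ^~ s.
  by apply: cM => x _; exact: H.
by near=> s => y; apply: (near Qs s).
Unshelve. all: by end_near. Qed.

Lemma compact_uniform_continuous (R : realType) (M N : metricType R)
    (g : M -> N) (eta : R) :
  compact [set: M] -> continuous g -> 0 < eta ->
  \forall s \near (0 : R)^'+, forall x y, mdist x y < s -> mdist (g x) (g y) < eta.
Proof.
move=> cM cg eta0; apply: compact_uniform => // x.
have eta20 : 0 < eta / 2 by exact: divr_gt0.
have /nbhs_mdist_ltP[r r0 rP] := cg x _ (near_mdist_lt (g x) eta20).
have r20 : 0 < r / 2 by exact: divr_gt0.
near=> y s => z /= yz.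
have xy : mdist x y < r / 2 by near: y; exact: near_mdist_lt.
have sr : s < r / 2 by near: s; exact: nbhs_right_lt.
have h1 : mdist (g x) (g y) < eta / 2 by apply: rP; lra.
have h2 : mdist (g x) (g z) < eta / 2.
  by apply: rP; have := metric_triangle x y z; lra.
have := metric_triangle (g y) (g x) (g z).
by rewrite (metric_sym (g y) (g x)); lra.
Unshelve. all: by end_near. Qed.

Lemma iter_continuous (M : topologicalType) (f : M -> M) k :
  continuous f -> continuous (iter k f).
Proof.
move=> cf; elim: k => [|k IH] x /=; first exact: cvg_id.
by apply: (@continuous_comp _ _ _ (iter k f) f); [exact: IH | exact: cf].
Qed.

Lemma finite_positive_lower_bound (R : realType) (k : nat) (u : nat -> R) :
  (forall i, (i < k)%N -> 0 < u i) ->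
  exists2 eta : R, 0 < eta & forall i, (i < k)%N -> eta <= u i.
Proof.
elim: k => [|k IH] u0; first by exists 1.
have [|eta eta0 etaP] := IH; first by move=> i ik; apply: u0; lia.
exists (Num.min eta (u k)); first by rewrite lt_min eta0 u0.
move=> i; rewrite ltnS leq_eqVlt => /orP[/eqP ->|ik].
  by rewrite ge_min lexx orbT.
by rewrite ge_min etaP.
Qed.

(** Origin of the spacing [(T + T).+2]: two times in a window of radius [T] lie in blocks of length
    [L] whose indices differ by less than this. *)
Lemma divz_dist (L T : nat) (a b : int) : (0 < L)%N ->
  `|a - b| <= (T + T)%N%:Z -> `|divz a L - divz b L| < (T + T).+2%:Z.
Proof.
move=> L0; have Lz : L%:Z != 0 by case: L L0.
have Lz0 : 0 < L%:Z by [].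
have := divz_eq a L; have := modz_ge0 a Lz; have := ltz_pmod a Lz0.
have := divz_eq b L; have := modz_ge0 b Lz; have := ltz_pmod b Lz0.
move: (divz a L) (modz a L) (divz b L) (modz b L) => q r q' r' *.
have : L%:Z * `|q - q'| <= (T + T)%N%:Z + L%:Z.
  have -> : L%:Z * `|q - q'| = `|a - b - (r - r')|.
    have -> : a - b - (r - r') = L%:Z * (q - q') by lia.
    by rewrite normrM.
  lia.
nia.
Qed.

(** Here [t] is a time of [f] and [divz t N] a time of [iter N f]. Block 0 carries the only passage
    of [z] along the second loop; windows around times far from 0 miss it, so that [z t] is close to
    [p t] there. *)
Lemma divz_far_neq0 (N L T : nat) (t i : int) : (0 < N)%N -> (0 < L)%N ->
  (N * (T + L).+1)%N%:Z <= `|t| -> `|i| <= T%:Z ->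
  divz (divz t N + i) L != 0.
Proof.
move=> N0 L0 tN iT; apply/negP => /eqP q0.
have Lz : L%:Z != 0 by case: L L0 {tN q0}.
have Lz0 : 0 < L%:Z by [].
have Nz : N%:Z != 0 by case: N N0 {tN q0}.
have Nz0 : 0 < N%:Z by [].
have := divz_eq (divz t N + i) L; rewrite q0 mul0r add0r.
have := modz_ge0 (divz t N + i) Lz; have := ltz_pmod (divz t N + i) Lz0.
move=> rL r0 rE; rewrite -rE in rL r0 => {rE q0}.
have := divz_eq t N; have := modz_ge0 t Nz; have := ltz_pmod t Nz0.
move: (divz t N) (modz t N) rL r0 => q r *.
nia.
Qed.

(** The coding concerns [iter N f], but a marker is observed at every iterate of [f]. The coded
    orbits are therefore filled in to [f]-orbits [F S], and [z 0] is separated from all other [z t]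
    and from all [p t]: a coincidence would make [z] periodic by injectivity of [f], and only
    finitely many distances matter because [p] is periodic and [z t] is near [p t] for large
    [|t|]. *)
Lemma bohr_chaotic_of_shift_coding (R : realType) (M : metricType R)
    (f finv : M -> M) (N L : nat) (Y : (int -> bool) -> int -> M) :
  compact [set: M] -> continuous f -> cancel finv f -> cancel f finv ->
  (0 < N)%N -> (0 < L)%N ->
  (forall S, full_orbit (iter N f) (Y S)) ->
  (forall eta : R, 0 < eta -> exists T : nat, forall S S' (c k : int),
     (forall i : int, `|i| <= T%:Z ->
        S (divz (c + i) L) = S' (divz (c + i) L - k)) ->
     mdist (Y S c) (Y S' (c - k * L%:Z)) <= eta) ->
  (exists j, Y (fun k => k == 0) j <> Y (fun=> false) j) ->
  bohr_chaotic f.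
Proof.
move=> cM cf fK finvK N0 L0 Yo window [j0 zpj].
have fI : injective f by exact: can_inj finvK.
have hI k : injective (iter k f) by elim: k => [//|k IH] x y /fI /IH.
have Nz : (N%:Z != 0) by lia.
pose F S := orbit_through f finv (Y S 0).
have Fo S : full_orbit f (F S) by exact: orbit_through_full.
have FY S i : F S (i * N%:Z) = Y S i.
  pose y i := F S (i * N%:Z).
  have yo : full_orbit (iter N f) y.
    by move=> k; rewrite /y mulrDl mul1r (full_orbitD (Fo S)).
  by apply: (full_orbit_inj (hI N) yo (Yo S) (j := 0)); rewrite /y mul0r.
pose z := F (fun k => k == 0); pose p := F (fun=> false).
(* The constant sequence is invariant under shifts of blocks; [window] for every [eta] turns this
   into equality of orbits. *)
have pper i (q : int) : p (i + q * (N * L)%:Z) = p i.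
  pose y i := p (i + q * (N * L)%:Z).
  have yo : full_orbit f y.
    exact: (full_orbit_shift (q * (N * L)%:Z) (Fo (fun=> false))).
  apply: (full_orbit_inj fI yo (Fo _) (j := 0)).
  apply: mdist_small_eq => eta eta0; have [T TP] := window _ eta0.
  have -> : y 0 = Y (fun=> false) (q * L%:Z) by rewrite /y /p -FY; congr F; lia.
  have := TP (fun=> false) (fun=> false) (q * L%:Z) q (fun _ _ => erefl).
  by rewrite subrr.
(* [z] is asymptotic to [p] at both ends, so that it would agree with [p] if it
   were periodic. *)
have zaper (t : int) : t != 0 -> ~ (forall i, z (i + t) = z i).
  move=> t0 zt; apply: zpj; rewrite -!FY.
  suff -> : F (fun k => k == 0) =1 p by [].
  apply: (full_orbit_inj fI (Fo _) (Fo _) (j := 0)).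
  apply: mdist_small_eq => eta eta0; have [T TP] := window _ eta0.
  have ztk (k : nat) i : z (i + t * k%:Z) = z i.
    elim: k i => [|k IH] i; first by rewrite mulr0 addr0.
    by rewrite intS mulrDr mulr1 addrA IH zt.
  pose m := t * L%:Z * (T.+1)%:Z.
  have zm : z 0 = Y (fun k => k == 0) m.
    rewrite -FY -/z -(ztk (N * L * T.+1)%N 0); congr z; rewrite /m; lia.
  have pm : p 0 = Y (fun=> false) m.
    by rewrite -FY -/p -(pper 0 (t * T.+1%:Z)); congr p; rewrite /m; lia.
  change (mdist (z 0) (p 0) <= eta); rewrite zm pm.
  have := TP (fun k => k == 0) (fun=> false) m 0; rewrite mul0r subr0; apply.
  move=> i iT; apply/negbTE/negP => /eqP mi0.
  have := divz_eq (m + i) L; rewrite mi0 mul0r add0r => E.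
  have := modz_ge0 (m + i) (d := L%:Z); have := ltz_mod (m + i) (d := L%:Z).
  rewrite -E => ml m0.
  have {}ml : m + i < L%:Z by have := ml; lia.
  have {}m0 : 0 <= m + i by apply: m0; lia.
  have : L%:Z * T.+1%:Z <= `|m|.
    by rewrite /m !normrM (_ : `|T.+1%:Z| = T.+1%:Z) //; nia.
  have : T.+1%:Z + L%:Z <= L%:Z * T.+1%:Z + 1 by nia.
  rewrite /m; lia.
have zne t : t != 0 -> z t <> z 0.
  move=> t0 zt; apply: (zaper _ t0) => i.
  have := full_orbit_inj fI (full_orbit_shift t (Fo (fun k => k == 0))) (Fo _) (j := 0).
  by rewrite add0r; apply.
have pne t : p t <> z 0.
  move=> pt.
  have ptz i : p (i + t) = z i.
    have := full_orbit_inj fI (full_orbit_shift t (Fo (fun=> false))) (Fo (fun k => k == 0)) (j := 0).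
    by rewrite add0r; apply.
  apply: (zaper (1 * (N * L)%:Z)); first by rewrite mul1r; lia.
  by move=> i; rewrite -!ptz addrAC pper.
(* Writing [t = q N + u] with [0 <= u < N], the window property at time [q] of [iter N f] passes to
   time [t] of [f] by uniform continuity of the finitely many [iter u f]. *)
have near_orbit eta : 0 < eta -> exists T : nat, forall S S' (t k : int),
    (forall i : int, `|i| <= T%:Z ->
      S (divz (divz t N + i) L) = S' (divz (divz t N + i) L - k)) ->
    mdist (F S t) (F S' (t - k * (N * L)%:Z)) <= eta.
  move=> eta0.
  have [de de0 deP] : exists2 de : R, 0 < de & forall u x y, (u < N)%N ->
      mdist x y < de -> mdist (iter u f x) (iter u f y) < eta.
    have uc : \forall s \near (0 : R)^'+, forall u : 'I_N, forall x y,
        mdist x y < s -> mdist (iter u f x) (iter u f y) < eta.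
      apply: filter_forall => u.
      by apply: compact_uniform_continuous => //; exact: iter_continuous.
    near (0 : R)^'+ => s; exists s => // u x y uN.
    exact: (near uc s _ (Ordinal uN)).
  have [T TP] := window _ (divr_gt0 de0 (ltr0n R 2)).
  exists T => S S' t k agree.
  have /= TS := TP _ _ _ _ agree.
  have FE S1 t' : F S1 (t' * N%:Z + (modz t N)) = iter (absz (modz t N)) f (Y S1 t').
    rewrite -FY -(full_orbitD (Fo S1)).
    by rewrite gez0_abs// modz_ge0.
  rewrite {1}(divz_eq t N) FE.
  have -> : t - k * (N * L)%:Z = (divz t N - k * L%:Z) * N%:Z + modz t N.
    by rewrite {1}(divz_eq t N) PoszM; ring.
  rewrite FE; apply/ltW/deP; last by apply: le_lt_trans TS _; lra.
  by rewrite -ltz_nat gez0_abs ?modz_ge0// ltz_pmod.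
(* The factor 4 leaves [3 eta1] for those [z t] that are [eta1]-close to [p t]; the factor 3 below
   leaves the [2 eta] required of markers for orbits [eta]-close to [z] or to [p]. *)
have [eta1 eta10 eta1p] : exists2 eta1 : R, 0 < eta1 &
    forall t, eta1 *+ 4 <= mdist (z 0) (p t).
  have [|e e0 eP] := @finite_positive_lower_bound R (N * L)
      (fun i => mdist (z 0) (p i%:Z) / 4).
    move=> i _; apply: divr_gt0 => //; rewrite mdist_gt0; apply/eqP => zp.
    exact: (pne i%:Z).
  exists e => // t.
  have NLz : (N * L)%:Z != 0 by rewrite eqz_nat -lt0n muln_gt0 N0.
  have NLz0 : 0 < (N * L)%:Z by rewrite ltz_nat muln_gt0 N0.
  rewrite (divz_eq t (N * L)%:Z) addrC pper -[modz _ _]gez0_abs ?modz_ge0//.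
  have := eP (absz (modz t (N * L)%:Z)).
  rewrite -ltz_nat gez0_abs ?modz_ge0// ltz_pmod// => /(_ isT).
  by rewrite ler_pdivlMr// mulr_natr.
have [eta eta0 [etaz etap]] : exists2 eta : R, 0 < eta &
    (forall t, t != 0 -> eta *+ 3 <= mdist (z 0) (z t)) /\
    (forall t, eta *+ 3 <= mdist (z 0) (p t)).
  have [T TP] := near_orbit _ eta10.
  pose K := (N * (T + L).+1)%N.
  (* Index [i] stands for [t = i - K]; at [i = K], that is [t = 0], the dummy value 1 keeps all
     entries positive. *)
  have [|e e0 eP] := @finite_positive_lower_bound R (K + K)
      (fun i => if i == K then 1 else mdist (z 0) (z (i%:Z - K%:Z)) / 3).
    move=> i _; case: eqP => // iK; apply: divr_gt0 => //.
    rewrite mdist_gt0; apply/eqP => zz; apply: (zne (i%:Z - K%:Z)) => //.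
    by clear -iK; lia.
  exists (Num.min e eta1); first by rewrite lt_min e0.
  have me : Num.min e eta1 <= e by rewrite ge_min lexx.
  have me1 : Num.min e eta1 <= eta1 by rewrite ge_min lexx orbT.
  split=> [t t0|t]; last first.
    by have := eta1p t; clear -me1 eta10; lra.
  have [tK|tK] := lerP K%:Z `|t|.
    have H i : `|i| <= T%:Z -> (divz (divz t N + i) L == 0) = false.
      by move=> iT; apply/negbTE; apply: divz_far_neq0 tK iT.
    have := TP (fun k => k == 0) (fun=> false) t 0 H.
    rewrite mul0r subr0 => zpt.
    have := eta1p t; have := metric_triangle (z 0) (z t) (p t).
    by move: zpt; rewrite -/z -/p; clear -me1 eta10; lra.
  have [t' [tE t'K t'nK]] : exists t' : nat,
      [/\ t = t'%:Z - K%:Z, (t' < K + K)%N & (t' == K) = false].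
    by exists (absz (t + K%:Z)); clear -tK t0; split; lia.
  have := eP t'; rewrite -tE t'K t'nK.
  by move=> /(_ isT); rewrite ler_pdivlMr//; clear -me e0; lra.
have [T TP] := near_orbit _ eta0.
pose B := (N * L * (T + T).+2)%N.
apply: (@bohr_chaotic_of_markers R M f B (z 0) eta) => //.
  by rewrite !muln_gt0 N0 L0.
move=> s; pose S (k : int) := match k with
  | Posz k => ((T + T).+2 %| k)%N && s (k %/ (T + T).+2)%N | Negz _ => false end.
exists (Y S 0) => i; rewrite -[iter i f _]/(F S i%:Z).
pose blk j := divz (divz i N + j) L.
have SP k : S k -> exists2 q, s q & k = ((T + T).+2 * q)%N%:Z.
  case: k => // k /andP[/dvdnP[q ->]]; rewrite mulnK// => sq.
  by exists q; rewrite // mulnC.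
have Sq q : S ((T + T).+2 * q)%N%:Z = s q by rewrite /S dvdn_mulr//= mulKn.
have blk0 q : i = (B * q)%N -> blk 0 = ((T + T).+2 * q)%N%:Z.
  move=> iE; rewrite /blk iE addr0 !divz_nat; congr Posz.
  by rewrite /B -!mulnA mulKn// mulKn.
(* Either the window of time [i] meets a prescribed passage, necessarily a single one, and the orbit
   looks like [z] translated by [B q]; or it meets none and the orbit looks like [p]. Only [i = B q]
   brings it near [z 0]. *)
have [[q sq [j jT jq]]|no] := pselect (exists2 q, s q &
    exists2 j, `|j| <= T%:Z & blk j = ((T + T).+2 * q)%N%:Z).
  have uniq_blk q' j' : `|j'| <= T%:Z -> blk j' = ((T + T).+2 * q')%N%:Z -> q' = q.
    move=> j'T j'q.
    have := @divz_dist L T (divz i N + j) (divz i N + j') L0.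
    rewrite -/(blk j) -/(blk j') jq j'q => H.
    have {H} := H (_ : _ <= _); clear -jT j'T => H.
    have {H} := H ltac:(lia); nia.
  have := TP S (fun k => k == 0) i%:Z ((T + T).+2 * q)%N%:Z.
  have -> : i%:Z - ((T + T).+2 * q)%N%:Z * (N * L)%N%:Z = i%:Z - (B * q)%N%:Z.
    by rewrite /B !PoszM; ring.
  move=> H; have {H} zi : mdist (F S i%:Z) (z (i%:Z - (B * q)%N%:Z)) <= eta.
    apply: H => j' j'T; rewrite -/(blk j') subr_eq0.
    apply/idP/eqP => [/SP[q' sq' j'q]|->]; last by rewrite Sq.
    by rewrite j'q (uniq_blk _ _ j'T j'q).
  have [iB|iB] := eqVneq i (B * q)%N.
    rewrite {1 2}iB dvdn_mulr//= mulKn; last by rewrite !muln_gt0 N0 L0.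
    by rewrite sq metric_sym; move: zi; rewrite {2}iB subrr.
  have -> : (B %| i)%N && s (i %/ B)%N = false.
    apply/negbTE/negP => /andP[/dvdnP[q' iE] _].
    move/negP: iB; apply; apply/eqP; rewrite iE mulnC; congr (_ * _)%N.
    apply: (uniq_blk _ 0); first by rewrite normr0.
    by apply: blk0; rewrite iE mulnC.
  have := etaz (i%:Z - (B * q)%N%:Z); rewrite subr_eq0 eqz_nat iB => /(_ isT).
  have := metric_triangle (z 0) (F S i%:Z) (z (i%:Z - (B * q)%N%:Z)).
  by move: zi; clear -eta0; lra.
have -> : (B %| i)%N && s (i %/ B)%N = false.
  apply/negbTE/negP => /andP[/dvdnP[q iE]]; rewrite iE mulnK; last by rewrite !muln_gt0 N0 L0.
  move=> sq; apply: no; exists q => //; exists 0; first by rewrite normr0.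
  by apply: blk0; rewrite iE mulnC.
have zi : mdist (F S i%:Z) (p i%:Z) <= eta.
  have := TP S (fun=> false) i%:Z 0; rewrite mul0r subr0; apply => j jT.
  apply/negbTE/negP => /SP[q sq jq]; apply: no; exists q => //.
  by exists j.
have := etap i%:Z; have := metric_triangle (z 0) (F S i%:Z) (p i%:Z).
by move: zi; clear -eta0; lra.
Unshelve. all: by end_near. Qed.

(** * Strict differentiability *)

Lemma rV_norm_le (R : realType) (n : nat) (v : 'rV[R]_n) (K : R) :
  0 <= K -> (forall i, `|v 0 i| <= K) -> `|v| <= K.
Proof.
move=> K0 vK; rewrite [leLHS]/Num.norm /= mx_normrE; apply/bigmax_leP.
by split=> // -[i j] _ /=; rewrite (ord1 i).
Qed.

Lemma rV_coord_le (R : realType) (n : nat) (v : 'rV[R]_n) i : `|v 0 i| <= `|v|.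
Proof.
by rewrite [leRHS]/Num.norm /= mx_normrE; apply/bigmax_geP; right; exists (0, i).
Qed.

Lemma rV_linear_le (R : realType) (n : nat) (W : normedModType R)
    (A : {linear 'rV[R]_n -> W}) v :
  `|A v| <= (\sum_j `|A (delta_mx 0 j)|) * `|v|.
Proof.
rewrite {1}(row_sum_delta v) linear_sum mulr_suml.
apply: le_trans (ler_norm_sum _ _ _) _; apply: ler_sum => j _.
by rewrite linearZ normrZ mulrC ler_wpM2l// rV_coord_le.
Qed.

Lemma rV_linear_continuous (R : realType) (n : nat) (W : normedModType R)
    (A : {linear 'rV[R]_n -> W}) : continuous A.
Proof.
apply: bounded_linear_continuous; apply/linear_boundedP.
near=> K => x; apply: le_trans (rV_linear_le A x) _.
by rewrite ler_wpM2r//; near: K; exact: nbhs_pinfty_ge.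
Unshelve. all: by end_near. Qed.

(** The norm on row vectors is the sup norm, so the scalar mean value theorem can be applied to each
    coordinate separately, at an intermediate point depending on the coordinate. *)
Lemma mean_value_le (R : realType) (V : normedModType R) (m : nat)
    (F : V -> 'rV[R]_m) (u w : V) (b : 'rV[R]_m) (K : R) :
  (forall t : R, 0 <= t <= 1 -> differentiable F (w + t *: (u - w)) /\
     `|'d F (w + t *: (u - w)) (u - w) - b| <= K) ->
  `|F u - F w - b| <= K.
Proof.
move=> H.
have K0 : 0 <= K.
  by have [|_] := H 0; rewrite ?lexx ?ler01//; exact: le_trans.
apply: rV_norm_le => // k.
pose g (t : R) := (F (w + t *: (u - w))) 0 k.
pose dg (t : R) := ('d F (w + t *: (u - w)) (u - w)) 0 k.
have gdg (t : R) : 0 <= t <= 1 -> is_derive t 1 g (dg t).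
  move=> t01; have [dF _] := H t t01.
  have cvgq : (fun h : R => h^-1 *: ((g \o shift t) (h *: (1 : R)) - g t)) @ 0^' --> dg t.
    have := @diff_derivable _ _ _ F _ (u - w) dF; rewrite /derivable.
    move=> /cvgP; rewrite -[lim _]/('D_(u - w) F _) deriveE// => cF.
    have := cvg_comp _ _ cF (@coord_continuous R 1 m 0 k ('d F (w + t *: (u - w)) (u - w))).
    apply: cvg_trans; apply: near_eq_cvg; near=> h.
    rewrite /= !mxE /g /=; congr (h^-1 *: (F _ 0 k - _)).
    by rewrite /shift /= [h%:A]mulr1 scalerDl addrCA.
  split; first by apply: cvgP cvgq.
  exact: cvg_lim cvgq.
have [|||t t01] := @MVT_segment R g dg 0 1.
- exact: ler01.
- by move=> t; rewrite in_itv /= => /andP[/ltW ? /ltW ?]; apply: gdg; apply/andP.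
- apply: derivable_within_continuous => t; rewrite in_itv /= => t01.
  by have [] := gdg t t01.
rewrite /g /dg scale0r scale1r addr0 subr0 mulr1 [w + (u - w)]addrC subrK => E.
rewrite in_itv /= in t01; have [_] := H t t01.
apply: le_trans; rewrite !mxE in E *; rewrite E.
by have := rV_coord_le ('d F (w + t *: (u - w)) (u - w) - b) k; rewrite !mxE.
Unshelve. all: by end_near. Qed.

Definition affine_error_le (R : realType) (V W : normedModType R)
    (F : V -> W) (y : V) (A : V -> W) (eta r : R) :=
  forall u w, `|y - u| < r -> `|y - w| < r ->
    `|F u - F w - A (u - w)| <= eta * `|u - w|.

(** Strict differentiability at [y], the pointwise residue of C^1. It controls the difference of two
    images, as a contraction argument requires, and it composes without any bookkeeping of open
    domains. *)
Definition strict_diff (R : realType) (V W : normedModType R)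
    (F : V -> W) (y : V) (A : V -> W) :=
  forall eta : R, 0 < eta -> exists2 r : R, 0 < r & affine_error_le F y A eta r.

Lemma near_norm_lt (R : realType) (V : normedModType R) (y : V) (r : R) :
  0 < r -> \forall u \near y, `|y - u| < r.
Proof. by move=> r0; apply/nbhs_normP; exists r. Qed.

Lemma nbhs_norm_ltP (R : realType) (V : normedModType R) (y : V) (A : set V) :
  nbhs y A <-> exists2 r : R, 0 < r & forall u, `|y - u| < r -> A u.
Proof.
split=> [/nbhs_normP[r /= r0 rA]|[r r0 rA]]; first by exists r.
exact: filterS rA (near_norm_lt y r0).
Qed.

Lemma ball_convex (R : realType) (V : normedModType R) (y u w : V) (r t : R) :
  `|y - u| < r -> `|y - w| < r -> 0 <= t <= 1 -> `|y - (w + t *: (u - w))| < r.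
Proof.
move=> yu yw /andP[t0 t1].
have -> : y - (w + t *: (u - w)) = (1 - t) *: (y - w) + t *: (y - u).
  have -> : u - w = (y - w) - (y - u) by rewrite opprB [RHS]addrC addrA subrK.
  rewrite opprD addrA; move: (y - w) (y - u) => a b.
  by rewrite scalerBr opprB scalerBl scale1r [RHS]addrAC -addrA.
apply: le_lt_trans (ler_normD _ _) _; rewrite !normrZ !ger0_norm ?subr_ge0//.
have [->|tn0] := eqVneq t 0; first by rewrite subr0 mul1r mul0r addr0.
have t0' : 0 < t by rewrite lt_neqAle eq_sym tn0.
have : t * `|y - u| < t * r by rewrite ltr_pM2l.
have : (1 - t) * `|y - w| <= (1 - t) * r by rewrite ler_wpM2l ?subr_ge0// ltW.
by lra.
Qed.

Lemma rV_linear_sub_le (R : realType) (n : nat) (W : normedModType R)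
    (A B : {linear 'rV[R]_n -> W}) (e : R) v :
  (forall j, `|A (delta_mx 0 j) - B (delta_mx 0 j)| <= e) ->
  `|A v - B v| <= n%:R * e * `|v|.
Proof.
move=> ABe.
have LE (L : {linear 'rV[R]_n -> W}) : L v = \sum_j v 0 j *: L (delta_mx 0 j).
  by rewrite {1}(row_sum_delta v) linear_sum; apply: eq_bigr => j _; rewrite linearZ.
rewrite !LE -sumrB; apply: le_trans (ler_norm_sum _ _ _) _.
have -> : n%:R * e * `|v| = \sum_(j < n) e * `|v|.
  by rewrite sumr_const card_ord -[RHS]mulr_natl mulrA.
apply: ler_sum => j _; rewrite -scalerBr normrZ mulrC.
by apply: ler_pM => //; exact: rV_coord_le.
Qed.

Lemma strict_diff_Ck1 (R : realType) (n m : nat) (U : set 'rV[R]_n)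
    (F : 'rV[R]_n -> 'rV[R]_m) (y : 'rV[R]_n) :
  open U -> Ck_on 1 U F -> U y -> strict_diff F y ('d F y).
Proof.
move=> oU [dF cdF] Uy eta eta0.
(* Dividing by [n.+1] rather than by [n] covers dimension 0. *)
have n10 : 0 < n.+1%:R :> R by [].
have : \forall x \near y, U x /\ forall j : 'I_n,
    `|'d F x (delta_mx 0 j) - 'd F y (delta_mx 0 j)| < eta / n.+1%:R.
  near=> x; split; first by near: x; exact: open_nbhs_nbhs.
  near: x; apply: filter_forall => j.
  have /nbhs_norm_ltP[r r0 rP] := cdF (delta_mx 0 j) y Uy _
     (near_norm_lt ('d F y (delta_mx 0 j)) (divr_gt0 eta0 n10)).
  apply/nbhs_norm_ltP; exists r; first exact: r0.
  move=> x yx; rewrite distrC; exact: rP x yx.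
move=> /nbhs_norm_ltP[r r0 rP]; exists r => // u w yu yw.
apply: mean_value_le => t t01.
have [Ux dx] := rP _ (ball_convex yu yw t01).
split; first exact: dF.
apply: le_trans (rV_linear_sub_le _ _) _; first by move=> j; apply/ltW/dx.
rewrite ler_wpM2r// mulrCA -[leRHS]mulr1 ler_wpM2l ?(ltW eta0)//.
by rewrite ler_pdivrMr// mul1r ler_nat.
Unshelve. all: by end_near. Qed.

Lemma affine_error_lipschitz (R : realType) (V W : normedModType R)
    (F : V -> W) (y : V) (A : V -> W) (eta r K : R) u w :
  affine_error_le F y A eta r -> (forall v, `|A v| <= K * `|v|) ->
  `|y - u| < r -> `|y - w| < r -> `|F u - F w| <= (K + eta) * `|u - w|.
Proof.
move=> FA AK yu yw; have := FA u w yu yw; have := AK (u - w).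
have := ler_normD (F u - F w - A (u - w)) (A (u - w)); rewrite subrK.
by rewrite mulrDl; lra.
Qed.

Lemma strict_diff_comp (R : realType) (V W Z : normedModType R)
    (F : V -> W) (G : W -> Z) (y : V) (A : {linear V -> W}) (B : {linear W -> Z})
    (KA KB : R) :
  (forall v, `|A v| <= KA * `|v|) -> (forall v, `|B v| <= KB * `|v|) ->
  strict_diff F y A -> strict_diff G (F y) B -> strict_diff (G \o F) y (B \o A).
Proof.
move=> AK BK FA GB eta eta0.
(* For [e <= 1], [c] dominates both the Lipschitz constant [|KA| + e] of [F] and the factor
   [|KA| + |KB| + e] of the composed error. The absolute values matter in a trivial space, where
   [KA] and [KB] may be negative. *)
pose c := `|KA| + `|KB| + 2.
have c1 : 1 <= c by rewrite /c; have := normr_ge0 KA; have := normr_ge0 KB; lra.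
have c0 : 0 < c by lra.
pose e := Num.min 1 (eta / (c * 2)).
have e0 : 0 < e by rewrite lt_min ltr01 divr_gt0// mulr_gt0.
have e1 : e <= 1 by rewrite ge_min lexx.
have ec : c * e <= eta / 2.
  have : e <= eta / (c * 2) by rewrite ge_min lexx orbT.
  by rewrite !ler_pdivlMr ?mulr_gt0//; lra.
have [r r0 rF] := FA _ e0; have [s s0 sG] := GB _ e0.
have AK' v : `|A v| <= `|KA| * `|v|.
  by apply: le_trans (AK v) _; rewrite ler_wpM2r// ler_norm.
have BK' v : `|B v| <= `|KB| * `|v|.
  by apply: le_trans (BK v) _; rewrite ler_wpM2r// ler_norm.
exists (Num.min r (s / c)); first by rewrite lt_min r0 divr_gt0.
have FL u : `|y - u| < Num.min r (s / c) -> `|F y - F u| < s.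
  rewrite lt_min => /andP[yu]; rewrite ltr_pdivlMr// => yus.
  have := affine_error_lipschitz rF AK' (u := y) (w := u); rewrite subrr normr0 => /(_ r0 yu).
  have : (`|KA| + e) * `|y - u| <= c * `|y - u|.
    by rewrite ler_wpM2r// /c; have := normr_ge0 KB; lra.
  by lra.
move=> u w yu yw /=.
have GFuw := sG _ _ (FL _ yu) (FL _ yw).
move: yu yw; rewrite !lt_min => /andP[yu _] /andP[yw _].
have Fuw := rF _ _ yu yw.
have FuwL := affine_error_lipschitz rF AK' yu yw.
have -> : G (F u) - G (F w) - B (A (u - w)) =
    (G (F u) - G (F w) - B (F u - F w)) + B (F u - F w - A (u - w)).
  by rewrite [B (_ - A _)]linearB /= addrA subrK.
apply: le_trans (ler_normD _ _) _.
have B2 := BK' (F u - F w - A (u - w)).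
have n0 := normr_ge0 (u - w).
have : e * `|F u - F w| <= e * ((`|KA| + e) * `|u - w|) by rewrite ler_wpM2l// ltW.
have : `|KB| * `|F u - F w - A (u - w)| <= `|KB| * (e * `|u - w|) by rewrite ler_wpM2l.
have : (`|KA| + `|KB| + e) * e * `|u - w| <= eta * `|u - w|.
  rewrite ler_wpM2r//; have : (`|KA| + `|KB| + e) * e <= c * e.
    by rewrite ler_wpM2r ?(ltW e0)// /c; lra.
  lra.
move: GFuw B2; clear; set a := `|G _ - _ - _|; set b := `|B _|.
set f := `|F u - F w|; set g := `|F u - F w - _|; set d := `|u - w|; lra.
Qed.

Lemma strict_diff_near_eq (R : realType) (V W : normedModType R)
    (F G : V -> W) (y : V) (A : V -> W) :
  (\forall x \near y, F x = G x) -> strict_diff F y A -> strict_diff G y A.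
Proof.
move=> /nbhs_norm_ltP[s s0 FG] FA eta eta0; have [r r0 rF] := FA _ eta0.
exists (Num.min r s); first by rewrite lt_min r0.
move=> u w; rewrite !lt_min => /andP[yu su] /andP[yw sw].
by rewrite -!FG//; apply: rF.
Qed.

Lemma strict_diff_id (R : realType) (V : normedModType R) (y : V) :
  strict_diff id y id.
Proof.
move=> eta eta0; exists 1 => // u w _ _.
by rewrite subrr normr0 mulr_ge0// ltW.
Qed.

Lemma strict_diff_diff (R : realType) (V W : normedModType R)
    (F : V -> W) (y : V) (A : {linear V -> W}) :
  continuous A -> strict_diff F y A ->
  differentiable F y /\ 'd F y = A :> (V -> W).
Proof.
move=> cA FA.
have H : F \o shift y = cst (F y) + A +o_ 0 id.
  apply/eqaddoP => eta eta0; have [r r0 rF] := FA _ eta0.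
  apply/nbhs_norm_ltP; exists r => // h; rewrite sub0r normrN => hr.
  have := rF (h + y) y; rewrite subrr normr0 addrK [h + y]addrC opprD addNKr normrN.
  move=> /(_ hr r0); rewrite !fctE /= opprD addrA [h + y]addrC.
  by [].
by split; [apply/diff_locallyP; rewrite (diff_unique cA H)|exact: diff_unique].
Qed.

(** Both affine approximations are compared on the segment from [y'] to [y' + t v], and the result
    is divided by [t]. This recovers continuity of the derivative from strict differentiability at
    single points. *)
Lemma affine_error_dist (R : realType) (V W : normedModType R)
    (F : V -> W) (y y' : V) (A A' : {linear V -> W}) (eta r : R) :
  affine_error_le F y A eta r -> `|y - y'| < r -> strict_diff F y' A' ->
  forall v, `|A v - A' v| <= eta * `|v|.
Proof.
move=> FA yy' FA' v; apply/ler_addgt0Pl => e e0.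
have v10 : 0 < `|v| + 1 by rewrite ltr_wpDl.
have [s s0 sF] := FA' _ (divr_gt0 e0 v10).
have : \forall t \near (0 : R)^'+, t * (`|v| + 1) < Num.min s (r - `|y - y'|).
  near=> t; rewrite -ltr_pdivlMr//; near: t; apply: nbhs_right_lt.
  by rewrite divr_gt0// lt_min s0 subr_gt0.
move=> tP; near (0 : R)^'+ => t.
have t0 : 0 < t by [].
have := near tP t _; rewrite lt_min => /(_ _)/andP[]// ts tr.
have tv : `|t *: v| <= t * (`|v| + 1) by rewrite normrZ gtr0_norm// ler_wpM2l ?(ltW t0)// lerDl.
have H1 := sF (y' + t *: v) y'.
have H2 := FA (y' + t *: v) y'.
have d1 : y' + t *: v - y' = t *: v by rewrite addrC addKr.
rewrite !d1 opprD addNKr normrN subrr normr0 in H1; rewrite !d1 in H2.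
have {}H1 := H1 (le_lt_trans tv ts) s0.
have {}H2 : `|F (y' + t *: v) - F y' - A (t *: v)| <= eta * `|t *: v|.
  apply: H2 => //; rewrite opprD addrA; apply: le_lt_trans (ler_normB _ _) _; lra.
rewrite -(ler_pM2l t0) -{1}(gtr0_norm t0) -normrZ scalerBr -!linearZ.
have -> : A (t *: v) - A' (t *: v) = (F (y' + t *: v) - F y' - A' (t *: v)) -
    (F (y' + t *: v) - F y' - A (t *: v)).
  by rewrite opprB [RHS]addrC addrA subrK.
apply: le_trans (ler_normB _ _) _.
have tE : `|t *: v| = t * `|v| by rewrite normrZ gtr0_norm.
have : e / (`|v| + 1) * `|t *: v| <= t * e.
  by rewrite tE mulrCA ler_wpM2l ?(ltW t0)// mulrAC ler_pdivrMr// ler_wpM2l ?(ltW e0)// lerDl.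
rewrite tE in H1 H2 *; lra.
Unshelve. all: by end_near. Qed.

Lemma affine_error_recenter (R : realType) (V W : normedModType R)
    (F : V -> W) (x y : V) (A B : V -> W) (eta eta' r r' : R) :
  affine_error_le F x A eta r -> (forall v, `|A v - B v| <= eta' * `|v|) ->
  `|x - y| + r' <= r -> affine_error_le F y B (eta + eta') r'.
Proof.
move=> FA AB rr u w yu yw.
have xr v : `|y - v| < r' -> `|x - v| < r.
  by have := ler_normD (x - y) (y - v); rewrite addrA subrK; lra.
have := ler_normD (F u - F w - A (u - w)) (A (u - w) - B (u - w)).
rewrite addrA subrK mulrDl; have := FA _ _ (xr _ yu) (xr _ yw).
have := AB (u - w); lra.
Qed.

Lemma norm_le_of_dist (R : realType) (V W : normedModType R)
    (A B : V -> W) (c e : R) :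
  (forall v, `|A v| <= c * `|v|) -> (forall v, `|A v - B v| <= e * `|v|) ->
  forall v, `|B v| <= (c + e) * `|v|.
Proof.
move=> Ac AB v; have := ler_normB (A v) (A v - B v).
rewrite opprB addrCA subrr addr0 mulrDl; have := Ac v; have := AB v; lra.
Qed.

(** * Shadowing for a hyperbolic chain of local maps *)

Lemma exp2_unbounded (R : realType) (x : R) : exists k, x < 2 ^+ k.
Proof.
exists (Num.bound x); have [x0|x0] := lerP 0 x; last first.
  by apply: lt_trans x0 _; exact: exprn_gt0.
by apply: lt_trans (archi_boundP x0) _; rewrite -natrX ltr_nat ltn_expl.
Qed.

Lemma geometric_cauchy_limit (R : realType) (n : nat) (u : nat -> 'rV[R]_n) (D : R) :
  0 <= D -> (forall k, `|u k - u k.+1| <= D / 2 ^+ k) ->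
  exists l, forall k, `|u k - l| <= 2 * D / 2 ^+ k.
Proof.
move=> D0 uD.
have tail k j : `|u k - u (k + j)%N| <= 2 * D / 2 ^+ k.
  suff : `|u k - u (k + j)%N| <= 2 * D / 2 ^+ k - 2 * D / 2 ^+ (k + j).
    move/le_trans; apply; rewrite lerBlDr lerDl.
    by rewrite divr_ge0 ?mulr_ge0 ?exprn_ge0.
  elim: j => [|j IH]; first by rewrite addn0 !subrr normr0.
  rewrite addnS; have := ler_normD (u k - u (k + j)%N) (u (k + j)%N - u (k + j).+1).
  rewrite addrA subrK; have := uD (k + j)%N.
  have -> : 2 * D / 2 ^+ (k + j).+1 = D / 2 ^+ (k + j).
    by rewrite exprS invfM mulrACA divff// mul1r.
  move: IH; rewrite -[2 * D / 2 ^+ (k + j)]mulrA; lra.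
have small (e : R) : 0 < e -> exists k, 2 * D / 2 ^+ k < e.
  move=> e0; have [k kP] := exp2_unbounded (2 * D / e).
  by exists k; rewrite ltr_pdivrMr ?exprn_gt0// [_ * 2 ^+ k]mulrC -ltr_pdivrMr.
have cu : cvg (u @ \oo).
  apply: cauchy_cvg; apply: cauchy_exP => e e0.
  have [k kP] := small _ e0; exists (u k); exists k => // j /= kj.
  rewrite -ball_normE /=; apply: le_lt_trans kP.
  by rewrite -(subnKC kj); exact: tail.
exists (lim (u @ \oo)) => k; apply/ler_addgt0Pl => e e0.
have /cvgrPdist_lt/(_ e e0)[N _ NP] := cu.
have := NP (k + N)%N (leq_addl _ _); have := tail k N.
have := ler_normD (u k - u (k + N)%N) (u (k + N)%N - lim (u @ \oo)).
rewrite addrA subrK [`|u (k + N)%N - _|]distrC; lra.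
Qed.

(* [F i] and [G i] are a map and its inverse, read in coordinates centred at
   [c i] and [c (i + 1)]; [A i] and [B i] are their derivatives at the centres,
   and [P i], [Q i] the projections on the stable and unstable directions. *)
Record hyperbolic_chain (R : realType) (n : nat) (F G : int -> 'rV[R]_n -> 'rV[R]_n)
    (A B P Q : int -> {linear 'rV[R]_n -> 'rV[R]_n}) (c : int -> 'rV[R]_n)
    (C K eta r : R) := HyperbolicChain {
  chain_F : forall i, affine_error_le (F i) (c i) (A i) eta r;
  chain_G : forall i, affine_error_le (G i) (c (i + 1)) (B i) eta r;
  chain_PQ : forall i v, P i v + Q i v = v;
  chain_PP : forall i v, P i (P i v) = P i v;
  chain_P : forall i v, `|P i v| <= C * `|v|;
  chain_Q : forall i v, `|Q i v| <= C * `|v|;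
  chain_PA : forall i v, `|P (i + 1) (A i v)| <= 8^-1 * `|v|;
  chain_QB : forall i v, `|Q i (B i v)| <= 8^-1 * `|v|;
  chain_AP : forall i v, `|A i (P i v)| <= 8^-1 * `|v|;
  chain_BQ : forall i v, `|B i (Q (i + 1) v)| <= 8^-1 * `|v|;
  chain_A : forall i v, `|A i v| <= K * `|v|;
  chain_B : forall i v, `|B i v| <= K * `|v|;
  chain_C1 : 1 <= C;
  chain_K0 : 0 <= K;
  chain_eta0 : 0 <= eta;
  chain_Ceta : C * eta <= 8^-1;
  chain_r : 0 < r
}.

Section hyperbolic_chain.
Context (R : realType) (n : nat) (F G : int -> 'rV[R]_n -> 'rV[R]_n)
    (A B P Q : int -> {linear 'rV[R]_n -> 'rV[R]_n}) (c : int -> 'rV[R]_n)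
    (C K eta r : R) (H : hyperbolic_chain F G A B P Q c C K eta r).

Definition chain_step (w : int -> 'rV[R]_n) (i : int) : 'rV[R]_n :=
  P i (F (i - 1) (w (i - 1))) + Q i (G i (w (i + 1))).

(** The factor 1/2 is the sum of a stable and an unstable quarter; each quarter is 1/8 from the
    derivative and 1/8 from the nonlinear error, bounded through [C * eta]. *)
Lemma chain_step_le (w w' : int -> 'rV[R]_n) (i : int) (D : R) :
  (forall j, j = i - 1 \/ j = i + 1 ->
     [/\ `|c j - w j| < r, `|c j - w' j| < r & `|w j - w' j| <= D]) ->
  `|chain_step w i - chain_step w' i| <= D / 2.
Proof.
move=> wD.
have [a1 a2 a3] := wD (i - 1) (or_introl erefl).
have [b1 b2 b3] := wD (i + 1) (or_intror erefl).
rewrite /chain_step opprD addrACA -!linearB /=.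
set x := w (i - 1) in a1 a3 *; set x' := w' (i - 1) in a2 a3 *.
set y := w (i + 1) in b1 b3 *; set y' := w' (i + 1) in b2 b3 *.
have C1 := chain_C1 H; have Ceta := chain_Ceta H.
have HP : `|P i (F (i - 1) x - F (i - 1) x')| <= 4^-1 * `|x - x'|.
  have FE := chain_F H a1 a2.
  have PF := chain_P H i (F (i - 1) x - F (i - 1) x' - A (i - 1) (x - x')).
  have PA := chain_PA H (i - 1) (x - x'); rewrite subrK in PA.
  have -> : F (i - 1) x - F (i - 1) x' =
    (F (i - 1) x - F (i - 1) x' - A (i - 1) (x - x')) + A (i - 1) (x - x').
    by rewrite subrK.
  rewrite linearD; apply: le_trans (ler_normD _ _) _.
  have : C * `|F (i - 1) x - F (i - 1) x' - A (i - 1) (x - x')| <= C * (eta * `|x - x'|).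
    by rewrite ler_wpM2l//; lra.
  have : C * eta * `|x - x'| <= 8^-1 * `|x - x'| by rewrite ler_wpM2r.
  move: PF PA; move: `|P _ _| `|P _ _| `|_ - _ - _| `|x - x'| => p q s t; lra.
have HQ : `|Q i (G i y - G i y')| <= 4^-1 * `|y - y'|.
  have GE := chain_G H b1 b2.
  have QG := chain_Q H i (G i y - G i y' - B i (y - y')).
  have QB := chain_QB H i (y - y').
  have -> : G i y - G i y' = (G i y - G i y' - B i (y - y')) + B i (y - y').
    by rewrite subrK.
  rewrite linearD; apply: le_trans (ler_normD _ _) _.
  have : C * `|G i y - G i y' - B i (y - y')| <= C * (eta * `|y - y'|).
    by rewrite ler_wpM2l//; lra.
  have : C * eta * `|y - y'| <= 8^-1 * `|y - y'| by rewrite ler_wpM2r.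
  move: QG QB; move: `|Q _ _| `|Q _ _| `|_ - _ - _| `|y - y'| => p q s t; lra.
apply: le_trans (ler_normD _ _) _; lra.
Qed.

(** Each use of the fixed point equation halves the distance and shortens the window by one time at
    both ends, since it involves the two neighbouring times. *)
Lemma chain_expansive (T : nat) (v v' : int -> 'rV[R]_n) :
  (forall i : int, `|i| <= T%:Z -> `|c i - v i| < r /\ `|c i - v' i| < r) ->
  (forall i : int, `|i| < T%:Z -> v i = chain_step v i /\ v' i = chain_step v' i) ->
  `|v 0 - v' 0| <= 2 * r / 2 ^+ T.
Proof.
move=> near_c fixed.
suff : forall k : nat, (k <= T)%N -> forall i : int, `|i| <= (T - k)%N%:Z ->
    `|v i - v' i| <= 2 * r / 2 ^+ k.
  by apply; rewrite ?leqnn// subnn normr0.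
elim=> [_ i iT|k IH kT i iT].
  have [] := near_c i; first by rewrite subn0 in iT.
  have := ler_normD (v i - c i) (c i - v' i); rewrite addrA subrK expr0 divr1 [`|v i - c i|]distrC.
  by move: `|_ - _| `|c i - v i| `|c i - v' i| => a b d; lra.
have [|-> ->] := fixed i; first by clear -iT kT; lia.
have -> : 2 * r / 2 ^+ k.+1 = 2 * r / 2 ^+ k / 2 by rewrite exprSr invfM mulrA.
apply: chain_step_le => j ij.
have jT : `|j| <= (T - k)%N%:Z by clear -ij iT kT; lia.
have [|? ?] := near_c j; first by clear -jT; lia.
by split=> //; apply: IH => //; exact: ltnW.
Qed.

(** Iteration starts at the centres, which [chain_step] moves by at most [2 C delta]; the halving
    displacements sum to [4 C delta]. A fixed point is not visibly an orbit, because its equation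
    mixes [F] and [G]. The lower bound on [r] keeps [F i (v i)] and [G i (v (i + 1))] in the balls
    where the affine estimates hold, which lets the two defects be compared. *)
Lemma chain_orbit (delta : R) :
  (forall i, `|c (i + 1) - F i (c i)| <= delta) ->
  (forall i, `|c i - G i (c (i + 1))| <= delta) ->
  (forall i w, `|c i - w| < r -> G i (F i w) = w) ->
  (forall i w, `|c (i + 1) - w| < r -> F i (G i w) = w) ->
  (K + 2) * (4 * C * delta) + delta < r ->
  exists2 v, forall i, v (i + 1) = F i (v i) &
    forall i, `|c i - v i| <= 4 * C * delta.
Proof.
move=> Fc Gc GFK FGK rbig.
have C1 := chain_C1 H; have K0 := chain_K0 H; have r0 := chain_r H.
have Ceta := chain_Ceta H; have eta0 := chain_eta0 H.
have eta8 : eta <= 8^-1.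
  by apply: le_trans Ceta; rewrite ler_peMl.
have delta0 : 0 <= delta by apply: le_trans (Fc 0).
have Cd0 : 0 <= C * delta by rewrite mulr_ge0//; lra.
have KCd0 : 0 <= K * (C * delta) by rewrite mulr_ge0.
have rho_r : 4 * C * delta < r by lra.
pose w k := iter k chain_step c.
have dw k : (forall i, `|c i - w k i| <= 4 * C * delta - 4 * C * delta / 2 ^+ k) /\
    (forall i, `|w k i - w k.+1 i| <= 2 * C * delta / 2 ^+ k).
  have pw0 j : 0 < (2 ^+ j)^-1 :> R by rewrite invr_gt0 exprn_gt0.
  elim: k => [|k [IH1 IH2]].
    split=> i; first by rewrite subrr normr0 expr0 divr1 subrr.
    rewrite /w /= /chain_step expr0 divr1 -{1}(chain_PQ H i (c i)) opprD addrACA -!linearB /=.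
    apply: le_trans (ler_normD _ _) _.
    have := chain_P H i (c i - F (i - 1) (c (i - 1))).
    have := chain_Q H i (c i - G i (c (i + 1))).
    have : C * `|c i - F (i - 1) (c (i - 1))| <= C * delta.
      by rewrite ler_wpM2l//; [lra|have := Fc (i - 1); rewrite subrK].
    have : C * `|c i - G i (c (i + 1))| <= C * delta by rewrite ler_wpM2l//; lra.
    move: `|P i _| `|Q i _| `|_ - F _ _| `|_ - G _ _| => *; lra.
  have D1 i : `|c i - w k.+1 i| <= 4 * C * delta - 4 * C * delta / 2 ^+ k.+1.
    have := ler_normD (c i - w k i) (w k i - w k.+1 i); rewrite addrA subrK.
    have := IH1 i; have := IH2 i.
    rewrite exprS invfM; move: `|_ - w k.+1 _| `|c i - w k i| `|w k i - w k.+1 i| => *; lra.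
  have lt_r k' : 4 * C * delta - 4 * C * delta / 2 ^+ k' < r :> R.
    apply: le_lt_trans rho_r; rewrite lerBlDr lerDl.
    by rewrite mulr_ge0 ?(ltW (pw0 _))//; lra.
  split=> // i.
  have -> : 2 * C * delta / 2 ^+ k.+1 = 2 * C * delta / 2 ^+ k / 2.
    by rewrite exprSr invfM mulrA.
  apply: (@chain_step_le (w k) (w k.+1)) => j _; split; last exact: IH2.
    exact: le_lt_trans (IH1 j) (lt_r k).
  exact: le_lt_trans (D1 j) (lt_r k.+1).
have /choice[v vP] : forall i, exists l, forall k,
    `|w k i - l| <= 2 * (2 * C * delta) / 2 ^+ k.
  move=> i; apply: geometric_cauchy_limit; first by lra.
  by move=> k; have [_] := dw k.
have vc i : `|c i - v i| <= 4 * C * delta.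
  by have := vP i 0%N; rewrite expr0 divr1 /w /=; move: `|_ - _| => *; lra.
have wr k i : `|c i - w k i| < r.
  have [/(_ i) + _] := dw k; move/le_lt_trans; apply; apply: le_lt_trans rho_r.
  by rewrite lerBlDr lerDl divr_ge0 ?exprn_ge0//; lra.
have vfix i : v i = chain_step v i.
  apply/eqP; rewrite -subr_eq0 -normr_le0; apply/ler_addgt0Pl => e e0; rewrite addr0.
  have [k kP] := exp2_unbounded (4 * C * delta * 2 / e).
  have {}kP : 4 * C * delta * 2 / 2 ^+ k < e.
    by rewrite ltr_pdivrMr ?exprn_gt0// [_ * 2 ^+ k]mulrC -ltr_pdivrMr.
  have := ler_normD (v i - w k.+1 i) (w k.+1 i - chain_step v i).
  rewrite addrA subrK [`|v i - _|]distrC.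
  have := vP i k.+1.
  have : `|w k.+1 i - chain_step v i| <= 2 * (2 * C * delta) / 2 ^+ k / 2.
    apply: chain_step_le => j _; split; last exact: vP.
      exact: wr.
    exact: le_lt_trans (vc j) rho_r.
  rewrite exprS invfM; move: `|w k.+1 i - v i| `|w k.+1 i - _| `|v i - _| => x y z.
  have p0 : 0 < (2 ^+ k)^-1 :> R by rewrite invr_gt0 exprn_gt0.
  have : 0 <= C * delta * (2 ^+ k)^-1 by rewrite mulr_ge0// ltW.
  by lra.
exists v => // i.
have vr j : `|c j - v j| < r := le_lt_trans (vc j) rho_r.
(* The defect [d] is unstable, the backward defect [d'] is stable, and each is
   up to a small error the image of the other: both vanish. *)
pose d := v (i + 1) - F i (v i); pose d' := v i - G i (v (i + 1)).
have PQ0 j u : P j (Q j u) = 0.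
  have := congr1 (P j) (chain_PQ H j u); rewrite linearD /= (chain_PP H).
  by rewrite -[RHS]addr0 => /addrI.
have QP0 j u : Q j (P j u) = 0.
  have := chain_PQ H j (P j u); rewrite (chain_PP H) -[RHS]addr0.
  by move=> /addrI.
have QQ j u : Q j (Q j u) = Q j u.
  by have := chain_PQ H j (Q j u); rewrite PQ0 add0r.
have dQ : d = Q (i + 1) d.
  rewrite -[LHS](chain_PQ H (i + 1)) [P _ d](_ : _ = 0) ?add0r// linearB /=.
  rewrite {1}(vfix (i + 1)) /chain_step addrK linearD /= PQ0 addr0 (chain_PP H).
  by rewrite subrr.
have d'P : d' = P i d'.
  rewrite -[LHS](chain_PQ H i) [Q _ d'](_ : _ = 0) ?addr0// linearB /=.
  rewrite {1}(vfix i) /chain_step linearD /= QP0 add0r QQ.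
  by rewrite subrr.
have step_r X Y (L : {linear 'rV[R]_n -> 'rV[R]_n}) (E : 'rV[R]_n -> 'rV[R]_n) x y :
  affine_error_le E x L eta r -> (forall u, `|L u| <= K * `|u|) ->
  `|y - E x| <= delta -> `|x - X| <= 4 * C * delta -> Y = E X -> `|y - Y| < r.
  move=> EL LK Ex xX ->.
  have xr : `|x - X| < r := le_lt_trans xX rho_r.
  have xx : `|x - x| < r by rewrite subrr normr0.
  have := affine_error_lipschitz EL LK xx xr.
  have := ler_normD (y - E x) (E x - E X); rewrite addrA subrK.
  have : (K + eta) * `|x - X| <= (K + 2) * (4 * C * delta).
    by apply: ler_pM => //; lra.
  lra.
have Gr : `|c i - G i (v (i + 1))| < r.
  by apply: (step_r (v (i + 1)) _ (B i) (G i) (c (i + 1))) => //; [exact: (chain_G H)|exact: (chain_B H)].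
have Fr : `|c (i + 1) - F i (v i)| < r.
  by apply: (step_r (v i) _ (A i) (F i) (c i)) => //; [exact: (chain_F H)|exact: (chain_A H)].
have dd' : `|d| <= 4^-1 * `|d'|.
  have := chain_F H Gr (vr i); rewrite FGK//.
  have := chain_AP H i d'; rewrite -d'P.
  have -> : G i (v (i + 1)) - v i = - d' by rewrite opprB.
  rewrite linearN opprK normrN -/d => Ad' Ed.
  have := ler_normB (d + A i d') (A i d'); rewrite addrK.
  have : eta * `|d'| <= 8^-1 * `|d'| by rewrite ler_wpM2r.
  by move: `|d| `|d + _| `|d'| `|A i d'| Ad' Ed => *; lra.
have d'd : `|d'| <= 4^-1 * `|d|.
  have := chain_G H Fr (vr (i + 1)); rewrite GFK//.
  have := chain_BQ H i d; rewrite -dQ.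
  have -> : F i (v i) - v (i + 1) = - d by rewrite opprB.
  rewrite linearN opprK normrN -/d' => Bd Ed'.
  have := ler_normB (d' + B i d) (B i d); rewrite addrK.
  have : eta * `|d| <= 8^-1 * `|d| by rewrite ler_wpM2r.
  by move: `|d| `|d' + _| `|d'| `|B i d| Bd Ed' => *; lra.
apply/eqP; rewrite -subr_eq0 -normr_le0 -/d.
by move: `|d| `|d'| (normr_ge0 d) dd' d'd => *; lra.
Qed.

End hyperbolic_chain.

(** * Derivatives in charts *)

Definition in_charts (R : realType) (n : nat) (M : topologicalType)
    (h : M -> M) (e e' : chart R n M) : 'rV[R]_n -> 'rV[R]_n :=
  chart_fun e' \o h \o chart_inv e.

Definition chart_diff (R : realType) (n : nat) (M : topologicalType)
    (h : M -> M) (e e' : chart R n M) (x : M) :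
    {linear 'rV[R]_n -> 'rV[R]_n} :=
  'd (in_charts h e e') (chart_fun e x).

(** Being stated at single points, for all pairs of charts, the property passes to iterates by
    [strict_diff_comp], the intermediate point being read in any chart around it. *)
Definition strictly_C1 (R : realType) (n : nat) (M : topologicalType)
    (S : smooth_structure R n M) (h : M -> M) :=
  continuous h /\ forall e e' x, atlas S e -> atlas S e' ->
    chart_dom e x -> chart_dom e' (h x) ->
    strict_diff (in_charts h e e') (chart_fun e x) (chart_diff h e e' x).

Section strictly_C1.
Context (R : realType) (n : nat) (M : topologicalType)
  (S : smooth_structure R n M).
Implicit Types (e : chart R n M) (x : M) (h : M -> M).

Lemma near_chart_fun h e e' x : continuous h -> chart_dom e x ->
  chart_dom e' (h x) ->
  \forall y \near chart_fun e x,
    chart_cod e y /\ chart_dom e' (h (chart_inv e y)).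
Proof.
move=> ch ex e'hx; have ey := chart_fun_cod ex.
near=> y; split.
  near: y; apply: open_nbhs_nbhs; split=> //; exact: chart_cod_open.
near: y; have := chart_inv_cont ey; rewrite /prop_for /continuous_at chart_funK// => ci.
have := cvg_comp _ _ ci (ch x); apply.
by apply: open_nbhs_nbhs; split=> //; exact: chart_dom_open.
Unshelve. all: by end_near. Qed.

Lemma open_chart_domain h e e' : continuous h ->
  open (chart_cod e `&` [set y | chart_dom e' (h (chart_inv e y))]).
Proof.
move=> ch; rewrite openE => y [ey e'y]; rewrite /interior.
have := @near_chart_fun h e e' (chart_inv e y) ch (chart_inv_dom ey) e'y.
by rewrite chart_invK.
Qed.

Lemma C1_map_strictly_C1 h : C1_map S h -> strictly_C1 S h.
Proof.
move=> [ch hC1]; split=> // e e' x Se Se' ex e'x.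
have Ux : (chart_cod e `&` [set y | chart_dom e' (h (chart_inv e y))]) (chart_fun e x).
  by split; [exact: chart_fun_cod | rewrite /= chart_funK].
exact: (strict_diff_Ck1 (@open_chart_domain h e e' ch) (hC1 e e' Se Se') Ux).
Qed.

Lemma strictly_C1_id : strictly_C1 S id.
Proof.
split=> [x|e e' x Se Se' ex e'x]; first exact: cvg_id.
have cid : continuous (@id M) by move=> ?; exact: cvg_id.
have Ux : (chart_cod e `&` [set y | chart_dom e' (chart_inv e y)]) (chart_fun e x).
  by split; [exact: chart_fun_cod | rewrite /= chart_funK].
exact: (strict_diff_Ck1 (@open_chart_domain id e e' cid) (atlas_compat Se Se' 1%N) Ux).
Qed.

Lemma rV_linear_bound (A : {linear 'rV[R]_n -> 'rV[R]_n}) :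
  exists K, forall v, `|A v| <= K * `|v|.
Proof. by eexists; exact: rV_linear_le. Qed.

Lemma strict_diff_chart_comp h1 h2 e m e' x :
  strictly_C1 S h1 -> strictly_C1 S h2 ->
  atlas S e -> atlas S m -> atlas S e' -> chart_dom e x ->
  chart_dom m (h1 x) -> chart_dom e' (h2 (h1 x)) ->
  strict_diff (in_charts (h2 \o h1) e e') (chart_fun e x)
    (chart_diff h2 m e' (h1 x) \o chart_diff h1 e m x).
Proof.
move=> [c1 d1] [c2 d2] Se Sm Se' ex mx e'x.
have [KA HA] := rV_linear_bound (chart_diff h1 e m x).
have [KB HB] := rV_linear_bound (chart_diff h2 m e' (h1 x)).
have H1 := d1 _ _ _ Se Sm ex mx.
have H2 := d2 _ _ _ Sm Se' mx e'x.
have E : in_charts h1 e m (chart_fun e x) = chart_fun m (h1 x).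
  by rewrite /in_charts /= chart_funK.
rewrite -E in H2; apply: strict_diff_near_eq (strict_diff_comp HA HB H1 H2).
have := near_chart_fun c1 ex mx; apply: filterS => y [ey my].
by rewrite /in_charts /= chart_funK.
Qed.

Lemma strict_diff_chart_diffE h e e' x (A : {linear 'rV[R]_n -> 'rV[R]_n}) :
  strict_diff (in_charts h e e') (chart_fun e x) A ->
  chart_diff h e e' x = A :> (_ -> _).
Proof. by move=> /strict_diff_diff -/(_ (@rV_linear_continuous _ _ _ A))[]. Qed.

Lemma chart_diff_comp h1 h2 e m e' x v :
  strictly_C1 S h1 -> strictly_C1 S h2 ->
  atlas S e -> atlas S m -> atlas S e' -> chart_dom e x ->
  chart_dom m (h1 x) -> chart_dom e' (h2 (h1 x)) ->
  chart_diff (h2 \o h1) e e' x v =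
  chart_diff h2 m e' (h1 x) (chart_diff h1 e m x v).
Proof.
move=> C1 C2 Se Sm Se' ex mx e'x.
have H := strict_diff_chart_comp C1 C2 Se Sm Se' ex mx e'x.
exact: (congr1 (fun g => g v) (@strict_diff_chart_diffE (h2 \o h1) e e' x
  (chart_diff h2 m e' (h1 x) \o chart_diff h1 e m x) H)).
Qed.

Lemma strictly_C1_comp h1 h2 :
  strictly_C1 S h1 -> strictly_C1 S h2 -> strictly_C1 S (h2 \o h1).
Proof.
move=> C1 C2; split; first by move=> x; apply: continuous_comp; [exact: C1.1|exact: C2.1].
move=> e e' x Se Se' ex e'x.
have H := strict_diff_chart_comp C1 C2 Se (chart_at_atlas S (h1 x)) Se' ex (chart_at_dom S _) e'x.
have E := @strict_diff_chart_diffE (h2 \o h1) e e' x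
  (chart_diff h2 _ e' (h1 x) \o chart_diff h1 e _ x) H.
by move: H; rewrite -E.
Qed.

Lemma strictly_C1_iter h k : strictly_C1 S h -> strictly_C1 S (iter k h).
Proof.
move=> C1; elim: k => [|k IH]; first exact: strictly_C1_id.
exact: (strictly_C1_comp IH C1).
Qed.

Lemma chart_diff_id e x v : chart_dom e x -> chart_diff id e e x v = v.
Proof.
move=> ex; suff /strict_diff_chart_diffE E :
  strict_diff (in_charts id e e) (chart_fun e x) (idfun : {linear 'rV[R]_n -> 'rV[R]_n}).
  exact: (congr1 (fun g => g v) E).
apply: strict_diff_near_eq (strict_diff_id _).
have cid : continuous (@id M) by move=> ?; exact: cvg_id.
have := near_chart_fun cid ex ex; apply: filterS => y [ey _].
by rewrite /in_charts /= chart_invK.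
Qed.

Lemma chart_diff_cancel h1 h2 e e' x v :
  strictly_C1 S h1 -> strictly_C1 S h2 -> cancel h1 h2 ->
  atlas S e -> atlas S e' -> chart_dom e x -> chart_dom e' (h1 x) ->
  chart_diff h2 e' e (h1 x) (chart_diff h1 e e' x v) = v.
Proof.
move=> C1 C2 hK Se Se' ex e'x.
rewrite -chart_diff_comp ?hK// (_ : h2 \o h1 = id) ?chart_diff_id//.
by apply/funext => y /=; rewrite hK.
Qed.

Lemma chart_diff_from_chart e x : chart_dom e x ->
  from_chart S e (chart_fun e x) = chart_diff id e (chart_at S x) x.
Proof. by move=> ex; rewrite /from_chart /chart_diff chart_funK. Qed.

End strictly_C1.

Lemma in_chartsE (R : realType) (n : nat) (M : topologicalType)
    (h : M -> M) (e e' : chart R n M) u :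
  in_charts h e e' u = chart_fun e' (h (chart_inv e u)).
Proof. by []. Qed.

(* Otherwise unification unfolds them to compare derivatives at different
   points. *)
Global Opaque chart_diff in_charts.

(** * Uniform estimates in a finite atlas *)

(** A chart may degenerate towards the boundary of its domain, so uniform estimates are made on the
    closed subsets [fa_dom k]. The Lebesgue number [fa_radius] lets one chart serve a point together
    with all its neighbours. *)
Record finite_atlas (R : realType) (n : nat) (M : metricType R)
    (S : smooth_structure R n M) := FiniteAtlas {
  fa_size : nat;
  fa_chart : 'I_fa_size -> chart R n M;
  fa_dom : 'I_fa_size -> set M;
  fa_radius : R;
  fa_atlas : forall k, atlas S (fa_chart k);
  fa_closed : forall k, closed (fa_dom k);
  fa_sub : forall k x, fa_dom k x -> chart_dom (fa_chart k) x;
  fa_radius_gt0 : 0 < fa_radius;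
  fa_lebesgue : forall x, exists k, forall y,
    mdist x y < fa_radius -> fa_dom k y
}.

Lemma closed_mdist_le (R : realType) (M : metricType R) (z : M) (r : R) :
  closed [set x | mdist z x <= r].
Proof.
move=> x H; rewrite /=; apply/ler_addgt0Pl => e e0.
have [y [/= zy xy]] := H _ (near_mdist_lt x e0).
by have := metric_triangle z y x; rewrite (metric_sym y); lra.
Qed.

Lemma finite_atlas_exists (R : realType) (n : nat) (M : metricType R)
    (S : smooth_structure R n M) :
  compact [set: M] -> exists fa : finite_atlas S, True.
Proof.
move=> cM.
have /choice[r rP] : forall x, exists r : R, 0 < r /\
    forall y, mdist x y <= r -> chart_dom (chart_at S x) y.
  move=> x; have : nbhs x (chart_dom (chart_at S x)).
    apply: open_nbhs_nbhs; split; [exact: chart_dom_open|exact: chart_at_dom].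
  move=> /nbhs_mdist_ltP[r r0 rP]; exists (r / 2); split; first exact: divr_gt0.
  by move=> y xy; apply: rP; lra.
have r20 x : 0 < r x / 2 by rewrite divr_gt0//; have [] := rP x.
have [s sP] := compact_finite_subcover cM r20.
pose z (k : 'I_(size s)) := tnth (in_tuple s) k.
near (0 : R)^'+ => rho.
have rhoP : forall k, rho <= r (z k) / 2.
  by near: rho; apply: filter_forall => ?; exact: nbhs_right_le.
unshelve eexists (@FiniteAtlas R n M S (size s) (fun k => chart_at S (z k))
  (fun k => [set y | mdist (z k) y <= r (z k)]) rho _ _ _ _ _) => //.
- by move=> k; exact: chart_at_atlas.
- by move=> k; exact: closed_mdist_le.
- by move=> k x /=; have [_] := rP (z k); apply.
move=> x; have [_ /(tnthP (in_tuple s))[k ->] yx] := sP x.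
exists k => w xw /=; rewrite -/(z k) in yx *.
by have := metric_triangle (z k) x w; have := rhoP k; lra.
Unshelve. all: by end_near. Qed.

Section finite_atlas.
Context (R : realType) (n : nat) (M : metricType R)
  (S : smooth_structure R n M) (fa : finite_atlas S)
  (cM : compact [set: M]).
Local Notation V := 'rV[R]_n.
Local Notation I := 'I_(fa_size fa).
Local Notation phi k := (chart_fun (fa_chart k)).
Local Notation psi k := (chart_inv (fa_chart k)).
Local Notation K := (@fa_dom _ _ _ _ fa).

Lemma uniform_on_closed (A : set M) (Q : M -> R -> Prop) : closed A ->
  (forall x, A x -> \forall y \near x & s \near (0 : R)^'+, A y -> Q y s) ->
  \forall s \near (0 : R)^'+, forall y, A y -> Q y s.
Proof.
move=> clA H; apply: compact_uniform => // x.
have [Ax|nAx] := pselect (A x); first exact: H.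
have nA : \forall y \near x, ~ A y.
  by apply: open_nbhs_nbhs; split => //; rewrite openC.
by near=> y s => /= Ay; exfalso; move: Ay; near: y.
Unshelve. all: by end_near. Qed.

Lemma near_chart_fun_lt (k : I) x (eps : R) : 0 < eps ->
  chart_dom (fa_chart k) x -> \forall y \near x, `|phi k x - phi k y| < eps.
Proof.
move=> eps0 dx; have cf := chart_fun_cont dx.
have := cf _ (near_norm_lt (phi k x) eps0). exact.
Qed.

Lemma uniform_chart_inv (eps : R) : 0 < eps ->
  \forall r \near (0 : R)^'+, forall (k : I) x, K k x ->
    forall v, `|phi k x - v| < r ->
    chart_cod (fa_chart k) v /\ mdist x (psi k v) < eps.
Proof.
move=> eps0; apply: filter_forall => k; apply: uniform_on_closed.
  exact: fa_closed.
move=> x Kx; have dx := fa_sub Kx.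
have : \forall v \near phi k x,
    chart_cod (fa_chart k) v /\ mdist x (psi k v) < eps / 2.
  near=> v; split.
    near: v; apply: open_nbhs_nbhs; split; first exact: chart_cod_open.
    exact: chart_fun_cod.
  near: v; have := chart_inv_cont (chart_fun_cod dx).
  rewrite /prop_for /continuous_at chart_funK// => ci.
  apply: (ci [set y | mdist x y < eps / 2]).
  by apply: near_mdist_lt; exact: divr_gt0.
move=> /nbhs_norm_ltP[s s0 sP].
have s20 : 0 < s / 2 by exact: divr_gt0.
near=> y r => /= Ky v yv.
have xy : mdist x y < eps / 2 by near: y; apply: near_mdist_lt; exact: divr_gt0.
have rs : r < s / 2 by near: r; exact: nbhs_right_lt.
have fxy : `|phi k x - phi k y| < s / 2.
  by near: y; exact: near_chart_fun_lt.
have [|vc xv] := sP v.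
  have := ler_normD (phi k x - phi k y) (phi k y - v); rewrite addrA subrK; lra.
split=> //; have := metric_triangle y x (psi k v).
by rewrite (metric_sym y x); lra.
Unshelve. all: by end_near. Qed.

Lemma uniform_chart_fun (eps : R) : 0 < eps ->
  \forall r \near (0 : R)^'+, forall (k : I) x, K k x ->
    forall y, mdist x y < r ->
    chart_dom (fa_chart k) y /\ `|phi k x - phi k y| < eps.
Proof.
move=> eps0; apply: filter_forall => k; apply: uniform_on_closed.
  exact: fa_closed.
move=> x Kx; have dx := fa_sub Kx.
have e20 : 0 < eps / 2 by exact: divr_gt0.
have : \forall v \near x,
    chart_dom (fa_chart k) v /\ `|phi k x - phi k v| < eps / 2.
  near=> v; split.
    by near: v; apply: open_nbhs_nbhs; split; first exact: chart_dom_open.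
  by near: v; exact: near_chart_fun_lt.
move=> /nbhs_mdist_ltP[s s0 sP].
have s20 : 0 < s / 2 by exact: divr_gt0.
near=> y r => /= Ky v yv.
have xy : mdist x y < s / 2 by near: y; exact: near_mdist_lt.
have rs : r < s / 2 by near: r; exact: nbhs_right_lt.
have [_ fy] := sP y ltac:(lra).
have [|dv fv] := sP v; first by have := metric_triangle x y v; lra.
split=> //; have := ler_normD (phi k y - phi k x) (phi k x - phi k v).
by rewrite addrA subrK [`|phi k y - _|]distrC; lra.
Unshelve. all: by end_near. Qed.

Lemma closed_chart_pair (h : M -> M) (k l : I) : continuous h ->
  closed [set x | K k x /\ K l (h x)].
Proof.
move=> ch; apply: closedI; first exact: fa_closed.
by apply: closed_comp => [x _|]; [exact: ch | exact: fa_closed].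
Qed.

(** An estimate with [eta / 2] at [x] serves all nearby centres [y]: by [affine_error_dist] the
    derivative at [y] differs from that at [x] by at most another [eta / 2]. *)
Lemma uniform_strict_diff (h : M -> M) (eta : R) : strictly_C1 S h -> 0 < eta ->
  \forall r \near (0 : R)^'+, forall (k l : I) x, K k x /\ K l (h x) ->
    affine_error_le (in_charts h (fa_chart k) (fa_chart l)) (phi k x)
      (chart_diff h (fa_chart k) (fa_chart l) x) eta r.
Proof.
move=> [ch hC1] eta0.
apply: filter_forall => k; apply: filter_forall => l.
apply: uniform_on_closed; first exact: closed_chart_pair.
move=> x [Kx Lx]; have dx := fa_sub Kx; have dhx := fa_sub Lx.
have sd y : chart_dom (fa_chart k) y -> chart_dom (fa_chart l) (h y) ->
    strict_diff (in_charts h (fa_chart k) (fa_chart l)) (phi k y)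
      (chart_diff h (fa_chart k) (fa_chart l) y).
  by move=> *; apply: hC1 => //; exact: fa_atlas.
have [s s0 sP] := sd _ dx dhx _ (divr_gt0 eta0 (ltr0n R 2)).
have s20 : 0 < s / 2 by exact: divr_gt0.
near=> y r => /= -[Ky Ly].
have rs : r < s / 2 by near: r; exact: nbhs_right_lt.
have fxy : `|phi k x - phi k y| < s / 2.
  by near: y; exact: near_chart_fun_lt.
have xy : `|phi k x - phi k y| < s by lra.
rewrite [eta]splitr; apply: (affine_error_recenter sP _ (r' := r)); last by lra.
exact: affine_error_dist sP xy (sd _ (fa_sub Ky) (fa_sub Ly)).
Unshelve. all: by end_near. Qed.

Lemma uniform_chart_diff_bound (h : M -> M) : strictly_C1 S h ->
  exists2 B : R, 0 < B & forall (k l : I) x, K k x -> K l (h x) ->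
    forall v, `|chart_diff h (fa_chart k) (fa_chart l) x v| <= B * `|v|.
Proof.
move=> [ch hC1].
(* Writing the bound as [r^-1] turns large bounds into small [r], the form in which compactness
   applies. *)
suff : \forall r \near (0 : R)^'+, forall (k l : I) x, K k x /\ K l (h x) ->
    forall v, `|chart_diff h (fa_chart k) (fa_chart l) x v| <= r^-1 * `|v|.
  move=> H; near (0 : R)^'+ => r; exists r^-1; first by rewrite invr_gt0.
  by move=> k l x Kx Lx v; apply: (near H r).
apply: filter_forall => k; apply: filter_forall => l.
apply: uniform_on_closed; first exact: closed_chart_pair.
move=> x [Kx Lx]; have dx := fa_sub Kx; have dhx := fa_sub Lx.
have sd y : chart_dom (fa_chart k) y -> chart_dom (fa_chart l) (h y) ->
    strict_diff (in_charts h (fa_chart k) (fa_chart l)) (phi k y)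
      (chart_diff h (fa_chart k) (fa_chart l) y).
  by move=> *; apply: hC1 => //; exact: fa_atlas.
have [s s0 sP] := sd _ dx dhx _ (ltr01).
have [B BP] := rV_linear_bound (chart_diff h (fa_chart k) (fa_chart l) x).
have B10 : 0 < `|B| + 1 by rewrite ltr_wpDl.
near=> y r => /= -[Ky Ly] v.
have fxy : `|phi k x - phi k y| < s.
  by near: y; exact: near_chart_fun_lt.
have rB : `|B| + 1 <= r^-1.
  rewrite -[leLHS]invrK lef_pV2 ?posrE ?invr_gt0//.
  by near: r; apply: nbhs_right_le; rewrite invr_gt0.
have BP' u : `|chart_diff h (fa_chart k) (fa_chart l) x u| <= `|B| * `|u|.
  by apply: le_trans (BP u) _; rewrite ler_wpM2r// ler_norm.
apply: (@le_trans _ _ ((`|B| + 1) * `|v|)); last by rewrite ler_wpM2r.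
apply: (norm_le_of_dist BP').
exact: affine_error_dist sP fxy (sd _ (fa_sub Ky) (fa_sub Ly)).
Unshelve. all: by end_near. Qed.

End finite_atlas.

(** * Comparison of the Riemannian and coordinate norms *)

Definition quad (R : realType) (n : nat) (a : 'I_n -> 'I_n -> R) (v : 'rV[R]_n) :=
  \sum_i \sum_j v 0 i * v 0 j * a i j.

Lemma quadZ (R : realType) (n : nat) (a : 'I_n -> 'I_n -> R) (t : R) v :
  quad a (t *: v) = t ^+ 2 * quad a v.
Proof.
rewrite /quad mulr_sumr; apply: eq_bigr => i _; rewrite mulr_sumr.
by apply: eq_bigr => j _; rewrite !mxE; ring.
Qed.

Lemma quad_continuous (R : realType) (n : nat) (a : 'I_n -> 'I_n -> R) :
  continuous (quad a).
Proof.
apply: continuous_big => [|i _]; first exact: add_continuous.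
apply: continuous_big => [|j _]; first exact: add_continuous.
have cc k : continuous (fun v : 'rV[R]_n => v 0 k) by exact: coord_continuous.
move=> v.
have cM := @continuousM R _ (fun v : 'rV[R]_n => v 0 i) (fun v : 'rV[R]_n => v 0 j) v (cc i v) (cc j v).
apply: (@continuousM R _ (fun v : 'rV[R]_n => v 0 i * v 0 j) (fun=> a i j) v cM).
exact: cst_continuous.
Qed.

Lemma quad_dist (R : realType) (n : nat) (a b : 'I_n -> 'I_n -> R) (e : R) v :
  (forall i j, `|a i j - b i j| <= e) ->
  `|quad a v - quad b v| <= e * n%:R ^+ 2 * `|v| ^+ 2.
Proof.
move=> ab; rewrite /quad -sumrB.
apply: le_trans (ler_norm_sum _ _ _) _.
have -> : e * n%:R ^+ 2 * `|v| ^+ 2 =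
    \sum_(i < n) \sum_(j < n) `|v| * `|v| * e.
  rewrite !sumr_const !card_ord -mulrnA -[RHS]mulr_natr natrM.
  by rewrite expr2; ring.
apply: ler_sum => i _; rewrite -sumrB.
apply: le_trans (ler_norm_sum _ _ _) _; apply: ler_sum => j _.
rewrite -mulrBr !normrM; apply: ler_pM => //.
by apply: ler_pM => //; exact: rV_coord_le.
Qed.

Lemma quad_lower_bound (R : realType) (n : nat) (a : 'I_n -> 'I_n -> R) :
  (forall v, v != 0 -> 0 < quad a v) ->
  exists2 c : R, 0 < c & forall v, c * `|v| ^+ 2 <= quad a v.
Proof.
move=> apos; pose A := [set v : 'rV[R]_n | `|v| = 1].
have q0 : quad a 0 = 0 by rewrite -[0](scale0r 0) quadZ expr0n mul0r.
have scale (c : R) : 0 < c -> (forall v, A v -> c <= quad a v) ->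
    forall v, c * `|v| ^+ 2 <= quad a v.
  move=> c0 cA v; have [->|v0] := eqVneq v 0.
    by rewrite q0 normr0 expr0n mulr0.
  have nv : 0 < `|v| by rewrite normr_gt0.
  have := cA (`|v|^-1 *: v); rewrite quadZ /A /= normrZ normrV ?unitfE ?gt_eqF//.
  rewrite normr_id mulVf ?gt_eqF// => /(_ erefl).
  by rewrite exprVn mulrC ler_pdivlMr ?exprn_gt0.
(* In dimension 0 the unit sphere is empty and any constant does; otherwise the minimum on the
   sphere is used. *)
have [A0|/set0P/negP] := pselect (A !=set0); last first.
  rewrite negbK => /eqP A0; exists 1 => //; apply: scale => // v.
  by rewrite A0.
have cA : compact A.
  apply: bounded_closed_compact.
    exists 1; split; first by rewrite realE ler01.
    by move=> x x1 v /= ->; exact: ltW.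
  rewrite (_ : A = (fun v : 'rV[R]_n => `|v|) @^-1` [set x | x = 1])//.
  by apply: closed_comp => [v _|]; [exact: norm_continuous|exact: closed_eq].
have [v0 v0A vmin] := EVT_min_rV A0 cA (continuous_subspaceT (@quad_continuous _ _ a)).
exists (quad a v0).
  apply: apos; rewrite -normr_gt0; have : A v0 by rewrite inE in v0A.
  by rewrite /A /= => ->.
apply: scale => [|v Av]; last by apply: vmin; rewrite inE.
apply: apos; rewrite -normr_gt0; have : A v0 by rewrite inE in v0A.
by rewrite /A /= => ->.
Qed.

Lemma quad_norm_le (R : realType) (n : nat) (a : 'I_n -> 'I_n -> R) (K : R) v :
  (forall i j, `|a i j| <= K) -> `|quad a v| <= K * n%:R ^+ 2 * `|v| ^+ 2.
Proof.
move=> aK; have := @quad_dist R n a (fun _ _ => 0) K v.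
have -> : quad (fun _ _ => 0) v = 0.
  by rewrite /quad big1// => i _; rewrite big1// => j _; rewrite mulr0.
by rewrite subr0; apply => i j; rewrite subr0.
Qed.

Lemma rdot_sum (R : realType) (n : nat) (M : topologicalType)
    (S : smooth_structure R n M) (g : riemannian_metric S) x
    (a : 'I_n -> R) (u : 'I_n -> 'rV[R]_n) w :
  rdot g x (\sum_i a i *: u i) w = \sum_i a i * rdot g x (u i) w.
Proof.
have g0 : rdot g x 0 w = 0.
  have := rdot_linear g x 1 0 0 w; rewrite scale1r addr0 mul1r -[LHS]addr0.
  by move=> /addrI.
elim/big_rec2 : _ => [|i y1 y2 _ <-]; first exact: g0.
exact: rdot_linear.
Qed.

Lemma rdot_frame (R : realType) (n : nat) (M : topologicalType)
    (S : smooth_structure R n M) (g : riemannian_metric S) x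
    (T : {linear 'rV[R]_n -> 'rV[R]_n}) v :
  rdot g x (T v) (T v) =
  quad (fun i j => rdot g x (T (delta_mx 0 i)) (T (delta_mx 0 j))) v.
Proof.
have TE : T v = \sum_j v 0 j *: T (delta_mx 0 j).
  by rewrite {1}(row_sum_delta v) linear_sum; apply: eq_bigr => j _; rewrite linearZ.
rewrite TE rdot_sum /quad; apply: eq_bigr => i _.
rewrite rdot_sym rdot_sum mulr_sumr; apply: eq_bigr => j _.
by rewrite mulrA rdot_sym.
Qed.

(** Here [qx] and [qy] are the values of the metric on one vector at [x] and at a nearby [y], and
    [w] is the coordinate norm of the vector. Since [c <= 1], one has [c ^+ 2 <= c <= c0 / 2] and
    [K1 <= c^-1 <= c^-1 ^+ 2], so the same [c] survives the square root. *)
Lemma perturbed_sqrt_bounds (R : realType) (c c0 K K1 d k qx qy w : R) :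
  0 < c0 -> 0 < K1 -> 0 <= w -> c0 * w ^+ 2 <= qx -> `|qx| <= k ->
  `|qy - qx| <= d -> d <= c0 / 2 * w ^+ 2 -> k <= K * w ^+ 2 ->
  K + c0 / 2 = K1 ->
  c = Num.min 1 (Num.min (c0 / 2) K1^-1) ->
  c * w <= Num.sqrt qy <= c^-1 * w.
Proof.
move=> c00 K10 w0 Hc HK Hd dc kK KE cE.
have c_gt0 : 0 < c by rewrite cE !lt_min ltr01 divr_gt0// invr_gt0.
have [c1 cc0 cK] : [/\ c <= 1, c <= c0 / 2 & c <= K1^-1].
  by split; rewrite cE !ge_min lexx ?orbT.
have ccc : c ^+ 2 <= c by rewrite expr2 ger_pMl.
have cK' : K1 <= c^-1 by rewrite -[K1]invrK lef_pV2 ?posrE ?invr_gt0.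
have ci1 : 1 <= c^-1 by rewrite invf_ge1.
have ccc' : c^-1 <= c^-1 ^+ 2 by rewrite expr2 ler_peMl ?invr_ge0// ltW.
have w2 := sqr_ge0 w.
move: HK Hd; rewrite !ler_norml => /andP[_ HK] /andP[H1 H2].
have lo : c0 / 2 * w ^+ 2 <= qy by lra.
have hi : qy <= K1 * w ^+ 2 by rewrite -KE; lra.
have cv0 : 0 <= c * w by rewrite mulr_ge0// ltW.
have civ0 : 0 <= c^-1 * w by rewrite mulr_ge0// invr_ge0 ltW.
have qy0 : 0 <= qy by apply: le_trans lo; rewrite mulr_ge0// divr_ge0// ltW.
rewrite -[X in X <= _ <= _](ger0_norm cv0) -[X in _ <= _ <= X](ger0_norm civ0).
rewrite -!sqrtr_sqr !ler_sqrt ?sqr_ge0// !exprMn.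
apply/andP; split.
  by apply: le_trans lo; rewrite ler_wpM2r// (le_trans ccc).
by apply: le_trans hi _; rewrite ler_wpM2r// (le_trans cK').
Qed.

Section rnorm.
Context (R : realType) (n : nat) (M : metricType R)
  (S : smooth_structure R n M) (g : riemannian_metric S).
Local Notation V := 'rV[R]_n.

Definition metric_coef (e : chart R n M) (y : M) (i j : 'I_n) : R :=
  rdot g y (chart_diff id e (chart_at S y) y (delta_mx 0 i))
           (chart_diff id e (chart_at S y) y (delta_mx 0 j)).

Lemma metric_coef_quad (e : chart R n M) y v :
  rdot g y (chart_diff id e (chart_at S y) y v)
           (chart_diff id e (chart_at S y) y v) = quad (metric_coef e y) v.
Proof. exact: rdot_frame. Qed.

Lemma metric_coef_chart (e : chart R n M) y i j : chart_dom e y ->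
  rdot g (chart_inv e (chart_fun e y)) (from_chart S e (chart_fun e y) (delta_mx 0 i))
   (from_chart S e (chart_fun e y) (delta_mx 0 j)) = metric_coef e y i j.
Proof. by move=> ey; rewrite chart_diff_from_chart// chart_funK. Qed.

Lemma chart_coef_ex (e : chart R n M) x i j :
  atlas S e -> chart_dom e x -> exists2 G : V -> R,
    forall y, chart_dom e y -> G (chart_fun e y) = metric_coef e y i j &
    {for chart_fun e x, continuous G}.
Proof.
move=> Se ex; eexists; last first.
  exact: (rdot_smooth g Se (delta_mx 0 i) (delta_mx 0 j) 0%N _ (chart_fun_cod ex)).
by move=> y ey; rewrite -metric_coef_chart.
Qed.

Lemma near_metric_coef (e : chart R n M) x i j (eps : R) :
  atlas S e -> chart_dom e x -> 0 < eps ->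
  \forall y \near x, `|metric_coef e y i j - metric_coef e x i j| < eps.
Proof.
move=> Se ex eps0.
have [G GE cG] : exists2 G : V -> R,
    forall y, chart_dom e y -> G (chart_fun e y) = metric_coef e y i j &
    {for chart_fun e x, continuous G} := chart_coef_ex i j Se ex.
have cf := chart_fun_cont ex.
have near1 := cf _ (cG _ (near_norm_lt (G (chart_fun e x) : R^o) eps0)).
near=> y.
have ey : chart_dom e y.
  by near: y; apply: open_nbhs_nbhs; split=> //; exact: chart_dom_open.
have Gy : `|G (chart_fun e x) - G (chart_fun e y)| < eps by near: y; exact: near1.
by rewrite distrC -(GE _ ex) -(GE _ ey).
Unshelve. all: by end_near. Qed.

(** The preferred charts jump with [y], but the Gram matrix of the metric in the fixed chart [e] is
    continuous. A change of its entries by [c0 / 2 / N] moves the quadratic form by at most half of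
    its lower bound. *)
Lemma near_rnorm (e : chart R n M) x : atlas S e -> chart_dom e x ->
  exists2 c : R, 0 < c & \forall y \near x, forall v,
    c * `|v| <= rnorm g y (chart_diff id e (chart_at S y) y v) <= c^-1 * `|v|.
Proof.
move=> Se ex.
have [|c0 c00 c0P] := @quad_lower_bound R n (metric_coef e x).
  move=> v v0; rewrite -metric_coef_quad; apply: rdot_pos; apply: contra v0 => /eqP Tv.
  have H := chart_diff_cancel v (strictly_C1_id S) (strictly_C1_id S) (fun=> erefl)
    Se (chart_at_atlas S x) ex (chart_at_dom S x).
  apply/eqP/(etrans (esym H)).
  exact: (etrans (congr1 (chart_diff id (chart_at S x) e x) Tv) (linear0 _)).
pose K0 : R := \sum_i \sum_j `|metric_coef e x i j|.
have K00 : 0 <= K0 by apply: sumr_ge0 => i _; apply: sumr_ge0.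
have coefK i j : `|metric_coef e x i j| <= K0.
  rewrite /K0 (bigD1 i)//= (bigD1 j)//=.
  rewrite -addrA lerDl addr_ge0 ?sumr_ge0// => k _; exact: sumr_ge0.
pose N := n%:R ^+ 2 + 1 : R.
have N1 : 1 <= N by rewrite lerDr sqr_ge0.
have N0 : 0 < N by lra.
pose K1 := K0 * N + c0 / 2.
have K10 : 0 < K1 by rewrite ltr_wpDl ?mulr_ge0 ?divr_gt0// ltW.
exists (Num.min 1 (Num.min (c0 / 2) K1^-1)).
  by rewrite !lt_min ltr01 divr_gt0// invr_gt0.
have near_coef : \forall y \near x, forall i j,
    `|metric_coef e y i j - metric_coef e x i j| <= c0 / 2 / N.
  apply: filter_forall => i; apply: filter_forall => j.
  have e0 : 0 < c0 / 2 / N by rewrite !divr_gt0.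
  by apply: filterS (near_metric_coef i j Se ex e0) => y /ltW.
near=> y => v.
have yx : forall i j, `|metric_coef e y i j - metric_coef e x i j| <= c0 / 2 / N.
  by near: y.
have NN : c0 / 2 / N * n%:R ^+ 2 * `|v| ^+ 2 <= c0 / 2 * `|v| ^+ 2.
  rewrite ler_wpM2r ?sqr_ge0// -mulrA ger_pMr ?divr_gt0// ler_pdivrMl// mulr1 /N; lra.
have NK : K0 * n%:R ^+ 2 * `|v| ^+ 2 <= K0 * N * `|v| ^+ 2.
  by rewrite ler_wpM2r ?sqr_ge0// ler_wpM2l// /N; lra.
rewrite /rnorm metric_coef_quad.
by apply: (perturbed_sqrt_bounds c00 K10 _ (c0P v) (quad_norm_le v coefK) (quad_dist v yx) NN NK).
Unshelve. all: by end_near. Qed.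

Lemma uniform_rnorm (fa : finite_atlas S) : compact [set: M] ->
  exists2 c : R, 0 < c & forall k x, fa_dom (f := fa) k x -> forall v,
    c * `|v| <= rnorm g x (chart_diff id (fa_chart k) (chart_at S x) x v)
    <= c^-1 * `|v|.
Proof.
move=> cM.
suff : \forall c \near (0 : R)^'+, forall k x, fa_dom (f := fa) k x -> forall v,
    c * `|v| <= rnorm g x (chart_diff id (fa_chart k) (chart_at S x) x v)
    <= c^-1 * `|v|.
  move=> H; near (0 : R)^'+ => c; exists c => //; exact: (near H c).
apply: filter_forall => k; apply: uniform_on_closed => //; first exact: fa_closed.
move=> x Kx; have [c c0 cP] := near_rnorm (fa_atlas k) (fa_sub Kx).
near=> y s => /= Ky v.
have sc : s <= c by near: s; exact: nbhs_right_le.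
have s0 : 0 < s by near: s; exact: nbhs_right_gt.
have /(_ v)/andP[lo hi] : forall v, c * `|v| <=
    rnorm g y (chart_diff id (fa_chart k) (chart_at S y) y v) <= c^-1 * `|v|.
  by near: y; exact: cP.
apply/andP; split.
  by apply: le_trans lo; rewrite ler_wpM2r.
by apply: le_trans hi _; rewrite ler_wpM2r// lef_pV2.
Unshelve. all: by end_near. Qed.

End rnorm.

(** * The hyperbolic splitting in charts *)

Section tangent_map.
Context (R : realType) (n : nat) (M : topologicalType)
  (S : smooth_structure R n M).
Local Notation V := 'rV[R]_n.

Lemma tangent_map_comp (h1 h2 : M -> M) x u :
  strictly_C1 S h1 -> strictly_C1 S h2 ->
  tangent_map S (h2 \o h1) x u = tangent_map S h2 (h1 x) (tangent_map S h1 x u).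
Proof.
move=> C1 C2; apply: (chart_diff_comp u C1 C2); try exact: chart_at_atlas.
- exact: chart_at_dom.
- exact: chart_at_dom.
- exact: chart_at_dom.
Qed.

Lemma tangent_map_id x u : tangent_map S id x u = u.
Proof. apply: chart_diff_id; exact: chart_at_dom. Qed.

Lemma tangent_map_cancel (h1 h2 : M -> M) x u :
  strictly_C1 S h1 -> strictly_C1 S h2 -> cancel h1 h2 ->
  tangent_map S h2 (h1 x) (tangent_map S h1 x u) = u.
Proof.
move=> C1 C2 hK; rewrite -tangent_map_comp// -[RHS](tangent_map_id x).
by congr (tangent_map S _ x u); apply/funext => y /=; rewrite hK.
Qed.

Definition to_tangent (e : chart R n M) x : {linear V -> V} :=
  chart_diff id e (chart_at S x) x.

Definition of_tangent (e : chart R n M) x : {linear V -> V} :=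
  chart_diff id (chart_at S x) e x.

Lemma to_tangentK e x : atlas S e -> chart_dom e x ->
  cancel (to_tangent e x) (of_tangent e x).
Proof.
move=> Se ex v.
exact: (chart_diff_cancel v (strictly_C1_id S) (strictly_C1_id S) (fun=> erefl)
  Se (chart_at_atlas S x) ex (chart_at_dom S x)).
Qed.

Lemma of_tangentK e x : atlas S e -> chart_dom e x ->
  cancel (of_tangent e x) (to_tangent e x).
Proof.
move=> Se ex v.
exact: (chart_diff_cancel v (strictly_C1_id S) (strictly_C1_id S) (fun=> erefl)
  (chart_at_atlas S x) Se (chart_at_dom S x) ex).
Qed.

Lemma to_tangent_chart_diff h e e' x v : strictly_C1 S h ->
  atlas S e -> atlas S e' -> chart_dom e x -> chart_dom e' (h x) ->
  to_tangent e' (h x) (chart_diff h e e' x v) =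
  tangent_map S h x (to_tangent e x v).
Proof.
move=> C1 Se Se' ex e'x.
have H1 := chart_diff_comp v C1 (strictly_C1_id S) Se Se' (chart_at_atlas S (h x))
  ex e'x (chart_at_dom S (h x)).
have H2 := chart_diff_comp v (strictly_C1_id S) C1 Se (chart_at_atlas S x)
  (chart_at_atlas S (h x)) ex (chart_at_dom S x) (chart_at_dom S (h x)).
exact: (etrans (esym H1) H2).
Qed.

Definition carries (h : M -> M) (E : M -> {vspace V}) (Lambda : set M) :=
  forall x, Lambda x -> Lambda (h x) /\
    forall u, u \in E x -> tangent_map S h x u \in E (h x).

Lemma carries_iter h E Lambda m : strictly_C1 S h -> carries h E Lambda ->
  carries (iter m h) E Lambda.
Proof.
move=> C1 hE; elim: m => [|m IH] x Lx.
  by split=> // u uE; rewrite tangent_map_id.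
have [Lmx mE] := IH x Lx; have [Lhx hEx] := hE _ Lmx; split=> // u uE.
have := @tangent_map_comp (iter m h) h x u (strictly_C1_iter m C1) C1.
move=> H; have {H} -> : tangent_map S (iter m.+1 h) x u =
  tangent_map S h (iter m h x) (tangent_map S (iter m h) x u) by exact: H.
by apply: hEx; exact: mE.
Qed.
End tangent_map.

(** The splitting is expressed by projections in the charts and the Riemannian norm is replaced by
    the coordinate norm, at the expense of [C]. Forward properties are recorded for [P] and backward
    ones for [Q], so that time reversal exchanges the two. *)
Record chart_splitting (R : realType) (n : nat) (M : metricType R)
    (S : smooth_structure R n M) (fa : finite_atlas S) (f finv : M -> M)
    (Lambda : set M)
    (P Q : 'I_(fa_size fa) -> M -> {linear 'rV[R]_n -> 'rV[R]_n})
    (C lambda : R) := ChartSplitting {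
  split_inv : forall x, Lambda x -> Lambda (f x) /\ Lambda (finv x);
  split_PQ : forall k x v, Lambda x -> fa_dom k x -> P k x v + Q k x v = v;
  split_PP : forall k x v, Lambda x -> fa_dom k x -> P k x (P k x v) = P k x v;
  split_P_forward : forall m k l x v, Lambda x -> fa_dom k x ->
    fa_dom l (iter m f x) ->
    P l (iter m f x) (chart_diff (iter m f) (fa_chart k) (fa_chart l) x v) =
    chart_diff (iter m f) (fa_chart k) (fa_chart l) x (P k x v);
  split_Q_backward : forall m k l x v, Lambda x -> fa_dom k x ->
    fa_dom l (iter m finv x) ->
    Q l (iter m finv x) (chart_diff (iter m finv) (fa_chart k) (fa_chart l) x v) =
    chart_diff (iter m finv) (fa_chart k) (fa_chart l) x (Q k x v);
  split_P_contract : forall m (k l : 'I_(fa_size fa)) x v, Lambda x -> fa_dom k x ->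
    fa_dom l (iter m f x) ->
    `|chart_diff (iter m f) (fa_chart k) (fa_chart l) x (P k x v)| <=
    C * lambda ^+ m * `|P k x v|;
  split_Q_contract : forall m (k l : 'I_(fa_size fa)) x v, Lambda x -> fa_dom k x ->
    fa_dom l (iter m finv x) ->
    `|chart_diff (iter m finv) (fa_chart k) (fa_chart l) x (Q k x v)| <=
    C * lambda ^+ m * `|Q k x v|
}.

Lemma ler_of_scaled (R : realType) (a c s t : R) : 0 < c ->
  c * s <= a * (c^-1 * t) -> s <= c^-1 ^+ 2 * a * t.
Proof.
move=> c0 H; rewrite -(ler_pM2l c0); apply: (le_trans H); rewrite le_eqVlt.
apply/orP; left; apply/eqP; field; exact: lt0r_neq0.
Qed.

Section splitting_exists.
Context (R : realType) (n : nat) (M : metricType R)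
  (S : smooth_structure R n M) (fa : finite_atlas S).
Local Notation V := 'rV[R]_n.

Definition chart_proj (Es Eu : M -> {vspace V}) (k : 'I_(fa_size fa)) x :
    {linear V -> V} :=
  of_tangent S (fa_chart k) x \o (daddv_pi (Es x) (Eu x) \o to_tangent S (fa_chart k) x).

Context (Es Eu : M -> {vspace V}) (Lambda : set M)
  (Esu : forall x, Lambda x ->
     (Es x + Eu x)%VS = fullv /\ (Es x :&: Eu x)%VS = 0%VS).

Lemma daddv_pi_compl x u : Lambda x ->
  daddv_pi (Es x) (Eu x) u + daddv_pi (Eu x) (Es x) u = u.
Proof.
by move=> Lx; have [full cap] := Esu Lx; apply: daddv_pi_add; rewrite ?full ?memvf.
Qed.

Lemma chart_projPQ k x v : Lambda x -> fa_dom k x ->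
  chart_proj Es Eu k x v + chart_proj Eu Es k x v = v.
Proof.
move=> Lx Kx; rewrite /chart_proj /= -linearD /= daddv_pi_compl//.
by rewrite to_tangentK//; [exact: fa_atlas|exact: fa_sub].
Qed.

Lemma to_tangent_proj k x v : Lambda x -> fa_dom k x ->
  to_tangent S (fa_chart k) x (chart_proj Es Eu k x v) =
  daddv_pi (Es x) (Eu x) (to_tangent S (fa_chart k) x v).
Proof.
move=> Lx Kx; rewrite /chart_proj /= of_tangentK//.
  exact: fa_atlas.
exact: fa_sub.
Qed.

Lemma chart_proj_idem k x v : Lambda x -> fa_dom k x ->
  chart_proj Es Eu k x (chart_proj Es Eu k x v) = chart_proj Es Eu k x v.
Proof.
move=> Lx Kx; have [_ cap] := Esu Lx.
exact: (congr1 (of_tangent S (fa_chart k) x) (etrans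
  (congr1 (daddv_pi (Es x) (Eu x)) (to_tangent_proj v Lx Kx)) (daddv_pi_proj _ cap))).
Qed.

(** Inclusion for both subbundles is enough: the image of the decomposition of a vector at [x] is a
    decomposition at [h x], and decompositions are unique. *)
Lemma chart_proj_equivariant h k l x v : strictly_C1 S h ->
  carries S h Es Lambda -> carries S h Eu Lambda ->
  Lambda x -> fa_dom k x -> fa_dom l (h x) ->
  chart_proj Es Eu l (h x) (chart_diff h (fa_chart k) (fa_chart l) x v) =
  chart_diff h (fa_chart k) (fa_chart l) x (chart_proj Es Eu k x v).
Proof.
move=> C1 hEs hEu Lx Kx Lhx.
have [Lh hEsx] := hEs x Lx; have [_ hEux] := hEu x Lx.
have [_ cap] := Esu Lx; have [_ cap'] := Esu Lh.
have cap'' : (Eu (h x) :&: Es (h x))%VS = 0%VS by rewrite capvC.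
have core u : daddv_pi (Es (h x)) (Eu (h x)) (tangent_map S h x u) =
    tangent_map S h x (daddv_pi (Es x) (Eu x) u).
  rewrite -{1}(daddv_pi_compl u Lx) !linearD /=.
  rewrite (daddv_pi_id cap'); last by apply: hEsx; exact: memv_pi.
  have := daddv_pi_compl (tangent_map S h x (daddv_pi (Eu x) (Es x) u)) Lh.
  rewrite (daddv_pi_id cap''); last by apply: hEux; exact: memv_pi.
  by rewrite -[RHS]add0r => /addIr ->; rewrite addr0.
have E1 := to_tangent_proj (chart_diff h (fa_chart k) (fa_chart l) x v) Lh Lhx.
have E2 w := to_tangent_chart_diff w C1 (fa_atlas k) (fa_atlas l) (fa_sub Kx) (fa_sub Lhx).
have E3 := to_tangent_proj v Lx Kx.
apply: (can_inj (to_tangentK (fa_atlas l) (fa_sub Lhx))).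
exact: (etrans E1 (etrans (congr1 _ (E2 _)) (etrans (core _)
  (esym (etrans (E2 _) (congr1 _ E3)))))).
Qed.

Lemma chart_proj_contract (g : riemannian_metric S) h (k l : 'I_(fa_size fa)) x v (c a : R) :
  strictly_C1 S h -> 0 < c -> 0 <= a -> Lambda x -> fa_dom k x -> fa_dom l (h x) ->
  (forall k x, fa_dom (f := fa) k x -> forall v,
    c * `|v| <= rnorm g x (to_tangent S (fa_chart k) x v) <= c^-1 * `|v|) ->
  (forall u, u \in Es x -> rnorm g (h x) (tangent_map S h x u) <= a * rnorm g x u) ->
  `|chart_diff h (fa_chart k) (fa_chart l) x (chart_proj Es Eu k x v)| <=
  c^-1 ^+ 2 * a * `|chart_proj Es Eu k x v|.
Proof.
move=> C1 c0 a0 Lx Kx Lhx cP con.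
set w := chart_proj Es Eu k x v.
have wE : to_tangent S (fa_chart k) x w \in Es x.
  by rewrite /w to_tangent_proj//; exact: memv_pi.
have /andP[_ hi] := cP k x Kx w.
have /andP[lo _] := cP l (h x) Lhx (chart_diff h (fa_chart k) (fa_chart l) x w).
have E := to_tangent_chart_diff w C1 (fa_atlas k) (fa_atlas l) (fa_sub Kx) (fa_sub Lhx).
have {}lo := eq_ind _ (fun t => is_true (_ <= rnorm g (h x) t)) lo _ E.
have H := le_trans (le_trans lo (con _ wE)) (ler_wpM2l a0 hi).
exact: (ler_of_scaled c0 H).
Qed.

End splitting_exists.

Lemma chart_splitting_exists (R : realType) (n : nat) (M : metricType R)
    (S : smooth_structure R n M) (fa : finite_atlas S) (g : riemannian_metric S)
    (f : C1_diffeo S) (Lambda : set M) :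
  compact [set: M] -> hyperbolic_set g f Lambda ->
  exists P Q C lambda, 0 < C /\ 0 < lambda < 1 /\
    @chart_splitting R n M S fa f (diffeo_inv f) Lambda P Q C lambda.
Proof.
move=> cM [_ fL [Es [Eu [c [lam [c0 lam01 H]]]]]].
have [cc cc0 ccP] := uniform_rnorm g fa cM.
have C1f := C1_map_strictly_C1 (diffeo_fun_C1 f).
have C1g := C1_map_strictly_C1 (diffeo_inv_C1 f).
have Lf x : Lambda x -> Lambda (f x) by move=> Lx; rewrite -fL; exists x.
have Lg x : Lambda x -> Lambda (diffeo_inv f x).
  by rewrite -{1}fL => -[y Ly <-]; rewrite diffeo_funK.
have Esu x : Lambda x -> (Es x + Eu x)%VS = fullv /\ (Es x :&: Eu x)%VS = 0%VS.
  by move=> /H[].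
have Eus x : Lambda x -> (Eu x + Es x)%VS = fullv /\ (Eu x :&: Es x)%VS = 0%VS.
  by move=> /Esu; rewrite addvC capvC.
(* Equality of the image with [E (f x)], rather than inclusion, makes the inverse carry [E] as
   well. *)
have carry (E : M -> {vspace 'rV[R]_n}) :
    (forall x, Lambda x -> (linfun (tangent_map S f x) @: E x)%VS = E (f x)) ->
    carries S f E Lambda /\ carries S (diffeo_inv f) E Lambda.
  move=> fE; split=> x Lx; (split; first by auto) => u uE.
    by rewrite -fE// -lfunE memv_img.
  have := uE; rewrite -{1}(diffeo_invK f x) -fE; last exact: Lg.
  case/memv_imgP => w wE ->; rewrite lfunE /=.
  rewrite -[X in tangent_map S (diffeo_inv f) X](diffeo_invK f x).
  by rewrite tangent_map_cancel//; exact: diffeo_funK.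
have [fEs gEs] : carries S f Es Lambda /\ carries S (diffeo_inv f) Es Lambda.
  by apply: carry => x /H[].
have [fEu gEu] : carries S f Eu Lambda /\ carries S (diffeo_inv f) Eu Lambda.
  by apply: carry => x /H[].
have lam0 m : 0 <= c * lam ^+ m.
  by case/andP: lam01 => l0 _; rewrite mulr_ge0 ?exprn_ge0// ltW.
(* The comparison of norms is used at both ends of the derivative, each time at the cost of a factor
   [cc^-1]. *)
exists (chart_proj Es Eu), (chart_proj Eu Es), (cc^-1 ^+ 2 * c), lam.
split; first by rewrite mulr_gt0// exprn_gt0// invr_gt0.
split=> //; split.
- by move=> x Lx; split; auto.
- by move=> k x v; exact: chart_projPQ.
- by move=> k x v; exact: chart_proj_idem.
- move=> m k l x v Lx Kx Lmx; apply: (chart_proj_equivariant Esu) => //.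
  + exact: strictly_C1_iter.
  + exact: carries_iter.
  + exact: carries_iter.
- move=> m k l x v Lx Kx Lmx; apply: (chart_proj_equivariant Eus) => //.
  + exact: strictly_C1_iter.
  + exact: carries_iter.
  + exact: carries_iter.
- move=> m k l x v Lx Kx Lmx; rewrite -[_ * c * _]mulrA.
  have con u : u \in Es x -> rnorm g (iter m f x) (tangent_map S (iter m f) x u) <=
      c * lam ^+ m * rnorm g x u by have [_ _ _ + _] := H x Lx; apply.
  exact: (@chart_proj_contract _ _ _ _ fa Es Eu Lambda g _ k l x v cc _
    (strictly_C1_iter m C1f) cc0 (lam0 m) Lx Kx Lmx ccP con).
- move=> m k l x v Lx Kx Lmx; rewrite -[_ * c * _]mulrA.
  have con u : u \in Eu x -> rnorm g (iter m (diffeo_inv f) x)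
      (tangent_map S (iter m (diffeo_inv f)) x u) <=
      c * lam ^+ m * rnorm g x u by have [_ _ _ _ +] := H x Lx; apply.
  exact: (@chart_proj_contract _ _ _ _ fa Eu Es Lambda g _ k l x v cc _
    (strictly_C1_iter m C1g) cc0 (lam0 m) Lx Kx Lmx ccP con).
Qed.

(** * Boundedness and uniform continuity of the projections *)

Lemma contraction_exponent (R : realType) (C lambda e : R) :
  0 < C -> 0 < lambda < 1 -> 0 < e ->
  exists m, (0 < m)%N /\ C * lambda ^+ m <= e.
Proof.
move=> C0 /andP[l0 l1] e0.
have : (fun m => lambda ^+ m) @ \oo --> (0 : R).
  by apply: cvg_expr; rewrite (ger0_norm (ltW l0)).
move=> /cvgrPdist_le/(_ (e / C) (divr_gt0 e0 C0))[m _ mP].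
exists m.+1; split => //; have := mP m.+1 (leqnSn m).
by rewrite sub0r normrN (ger0_norm (exprn_ge0 _ (ltW l0))) ler_pdivlMr// mulrC.
Qed.

(** Arithmetic of [small_stable_part]: [u] is the unstable part of [v] at [y], [s] and [q] are the
    stable and unstable parts of [u] at [x], and [Dp], [Dq] are their images under the derivative at
    [x]. From [Dp = Dxu - Dq] one gets [|Dp| <= (2 + C1) |u|], whence the threshold on the
    contraction factor [t]. *)
Lemma small_part_estimate (R : realType) (V W : normedModType R)
    (Dxu Dyu Dp Dq : W) (u q s v : V) (t C1 tau : R) :
  1 <= C1 -> 0 < tau -> t <= Num.min 1 (tau / ((2 + C1) * C1)) ->
  `|Dxu - Dyu| <= 1 * `|u| -> `|Dyu| <= t * `|u| -> `|Dq| <= t * `|q| ->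
  `|s| <= t * `|Dp| -> `|u| <= C1 * `|v| -> `|q| <= C1 * `|u| ->
  Dp + Dq = Dxu -> `|s| <= tau * `|v|.
Proof.
move=> C11 tau0 tth Dxy Hy HQ Hs u1 u2 H5.
have D0 : 0 < (2 + C1) * C1 by rewrite mulr_gt0//; lra.
have t1 : t <= 1 by apply: (le_trans tth); rewrite ge_min lexx.
have tt : t * ((2 + C1) * C1) <= tau.
  by rewrite -ler_pdivlMr//; apply: (le_trans tth); rewrite ge_min lexx orbT.
have [t0|tneg] := lerP 0 t; last first.
  apply: (le_trans Hs); apply: (@le_trans _ _ 0).
    by rewrite mulr_le0_ge0// ltW.
  by rewrite mulr_ge0// ltW.
have n1 : `|Dp| <= (2 + C1) * `|u|.
  have T1 := ler_normB Dxu Dq; rewrite -{1}H5 addrK in T1.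
  have T2 := ler_normD (Dxu - Dyu) Dyu; rewrite subrK in T2.
  have T3 : t * `|u| <= 1 * `|u| by rewrite ler_wpM2r.
  have T4 : t * `|q| <= 1 * `|q| by rewrite ler_wpM2r.
  by rewrite mulrDl; lra.
have n2 : (2 + C1) * `|u| <= (2 + C1) * (C1 * `|v|) by rewrite ler_wpM2l//; lra.
apply: (le_trans Hs); apply: (@le_trans _ _ (t * ((2 + C1) * (C1 * `|v|)))).
  by rewrite ler_wpM2l//; lra.
rewrite !mulrA -[t * _ * _]mulrA.
by rewrite ler_wpM2r.
Qed.

Section splitting.
Context (R : realType) (n : nat) (M : metricType R)
  (S : smooth_structure R n M) (fa : finite_atlas S) (cM : compact [set: M]).
Local Notation V := 'rV[R]_n.
Local Notation I := 'I_(fa_size fa).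

Lemma iter_cancel (T : Type) (h1 h2 : T -> T) m :
  cancel h1 h2 -> cancel (iter m h1) (iter m h2).
Proof. by move=> hK; elim: m => [//|m IH] x; rewrite iterSr iterS hK IH. Qed.

Lemma splitting_QQ f finv Lambda P Q C lambda k x v :
  @chart_splitting R n M S fa f finv Lambda P Q C lambda ->
  Lambda x -> fa_dom k x -> Q k x (Q k x v) = Q k x v.
Proof.
move=> sp Lx Kx.
have PQ0 : P k x (Q k x v) = 0.
  have := congr1 (P k x) (split_PQ sp v Lx Kx).
  by rewrite linearD /= (split_PP sp)// -[RHS]addr0 => /addrI.
by have := split_PQ sp (Q k x v) Lx Kx; rewrite PQ0 add0r.
Qed.

Lemma splitting_swap f finv Lambda P Q C lambda :
  @chart_splitting R n M S fa f finv Lambda P Q C lambda ->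
  @chart_splitting R n M S fa finv f Lambda Q P C lambda.
Proof.
move=> sp; split.
- by move=> x /(split_inv sp)[].
- by move=> k x v Lx Kx; rewrite addrC (split_PQ sp).
- by move=> k x v Lx Kx; exact: (splitting_QQ v sp Lx Kx).
- exact: (split_Q_backward sp).
- exact: (split_P_forward sp).
- exact: (split_Q_contract sp).
- exact: (split_P_contract sp).
Qed.

Lemma split_iter f finv Lambda P Q C lambda m x :
  @chart_splitting R n M S fa f finv Lambda P Q C lambda ->
  Lambda x -> Lambda (iter m f x).
Proof.
by move=> sp Lx; elim: m => //= m IH; have [] := split_inv sp IH.
Qed.

Lemma split_Q_forward f finv Lambda P Q C lambda m k l x v :
  @chart_splitting R n M S fa f finv Lambda P Q C lambda ->
  Lambda x -> fa_dom k x -> fa_dom l (iter m f x) ->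
  Q l (iter m f x) (chart_diff (iter m f) (fa_chart k) (fa_chart l) x v) =
  chart_diff (iter m f) (fa_chart k) (fa_chart l) x (Q k x v).
Proof.
move=> sp Lx Kx Kfx.
have E1 := split_PQ sp (chart_diff (iter m f) (fa_chart k) (fa_chart l) x v)
  (split_iter m sp Lx) Kfx.
have E2 := congr1 (chart_diff (iter m f) (fa_chart k) (fa_chart l) x) (split_PQ sp v Lx Kx).
have E3 := split_P_forward sp v Lx Kx Kfx.
have E4 := linearD (chart_diff (iter m f) (fa_chart k) (fa_chart l) x) (P k x v) (Q k x v).
apply: (@addrI _ (P l (iter m f x) (chart_diff (iter m f) (fa_chart k) (fa_chart l) x v))).
exact: (etrans E1 (etrans (esym E2) (etrans E4 (congr1 (fun t => t + _) (esym E3))))).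
Qed.

(* An unstable component is recovered from its forward image by the contraction
   of the inverse. *)
Lemma split_Q_expand f finv Lambda P Q C lambda m (k l : I) x v :
  @chart_splitting R n M S fa f finv Lambda P Q C lambda ->
  strictly_C1 S f -> strictly_C1 S finv -> cancel f finv ->
  Lambda x -> fa_dom k x -> fa_dom l (iter m f x) ->
  `|Q k x v| <= C * lambda ^+ m *
     `|chart_diff (iter m f) (fa_chart k) (fa_chart l) x (Q k x v)|.
Proof.
move=> sp C1 C1' fK Lx Kx Kfx.
have gfx : iter m finv (iter m f x) = x by rewrite (iter_cancel m fK).
have Kgfx : fa_dom k (iter m finv (iter m f x)) by rewrite gfx.
have H := split_Q_contract sp (chart_diff (iter m f) (fa_chart k) (fa_chart l) x v)
  (split_iter m sp Lx) Kfx Kgfx.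
have E := split_Q_forward v sp Lx Kx Kfx.
have E' := chart_diff_cancel (Q k x v) (strictly_C1_iter m C1) (strictly_C1_iter m C1')
  (iter_cancel m fK) (fa_atlas k) (fa_atlas l) (fa_sub Kx) (fa_sub Kfx).
have {}H := eq_ind _ (fun t => is_true (`|chart_diff (iter m finv) (fa_chart l) (fa_chart k)
   (iter m f x) t| <= C * lambda ^+ m * `|t|)) H _ E.
exact: (eq_ind _ (fun t => is_true (`|t| <= _)) H _ E').
Qed.

(* [Df^m] at least doubles the unstable part and halves the stable one, while its
   norm is bounded; no continuity of the splitting is needed. *)
Lemma splitting_bounded f finv Lambda P Q C lambda :
  @chart_splitting R n M S fa f finv Lambda P Q C lambda ->
  strictly_C1 S f -> strictly_C1 S finv -> cancel f finv ->
  0 < C -> 0 < lambda < 1 ->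
  exists2 C1 : R, 1 <= C1 & forall k x v, Lambda x -> fa_dom k x ->
    `|P k x v| <= C1 * `|v| /\ `|Q k x v| <= C1 * `|v|.
Proof.
move=> sp C1 C1' fK C0 lam01.
have [m [_ mP]] := contraction_exponent C0 lam01 (divr_gt0 ltr01 (ltr0n R 2)).
have [B B0 BP] := uniform_chart_diff_bound fa cM (strictly_C1_iter m C1).
(* With [p], [q] the two parts of [v]: [|q| <= |Dq| / 2 <= (B |v| + |p| / 2) / 2] and
   [|p| <= |v| + |q|], so that both are at most [(B + 2) |v|]. *)
exists (B + 2); first by lra.
move=> k x v Lx Kx.
have [l lP] := fa_lebesgue fa (iter m f x).
have Kfx : fa_dom l (iter m f x) by apply: lP; rewrite mdistxx fa_radius_gt0.
have H1 := split_P_contract sp v Lx Kx Kfx.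
have H2 := split_Q_expand v sp C1 C1' fK Lx Kx Kfx.
have H3 := BP k l x Kx Kfx v.
have H4 := split_PQ sp v Lx Kx.
have H5 := linearD (chart_diff (iter m f) (fa_chart k) (fa_chart l) x) (P k x v) (Q k x v).
have {}H5 := etrans (esym H5) (congr1 (chart_diff (iter m f) (fa_chart k) (fa_chart l) x) H4).
move: H1 H2 H3 H4 H5.
move: (chart_diff (iter m f) (fa_chart k) (fa_chart l) x v).
move: (chart_diff (iter m f) (fa_chart k) (fa_chart l) x (P k x v)).
move: (chart_diff (iter m f) (fa_chart k) (fa_chart l) x (Q k x v)).
move: (P k x v) (Q k x v) => p q Dq Dp Dv H1 H2 H3 H4 H5.
have {}H1 : `|Dp| <= 2^-1 * `|p|.
  by apply: (le_trans H1); rewrite ler_wpM2r//; lra.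
have {}H2 : `|q| <= 2^-1 * `|Dq|.
  by apply: (le_trans H2); rewrite ler_wpM2r//; lra.
have T1 := ler_normB Dv Dp; rewrite -{1}H5 addrC addKr in T1.
have T2 := ler_normB v q; rewrite -{1}H4 addrK in T2.
have v0 := normr_ge0 v; have Bv0 : 0 <= B * `|v| by rewrite mulr_ge0// ltW.
by rewrite !mulrDl; split; lra.
Qed.

(* The unstable vector [Q k y v] is contracted by [Df^-m] at [y], hence also at
   the nearby point [x], where a stable component would be expanded. *)
Lemma small_stable_part f finv Lambda P Q C lambda (C1 tau : R) :
  @chart_splitting R n M S fa f finv Lambda P Q C lambda ->
  strictly_C1 S f -> strictly_C1 S finv -> cancel f finv -> cancel finv f ->
  0 < C -> 0 < lambda < 1 -> 1 <= C1 ->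
  (forall k x v, Lambda x -> fa_dom k x ->
    `|P k x v| <= C1 * `|v| /\ `|Q k x v| <= C1 * `|v|) ->
  0 < tau ->
  \forall d \near (0 : R)^'+, forall k x y v, Lambda x -> Lambda y ->
    fa_dom k x -> fa_dom k y -> mdist x y < d ->
    `|P k x (Q k y v)| <= tau * `|v|.
Proof.
move=> sp C1f C1g fK gK C0 lam01 C11 C1P tau0.
have C10 : 0 < C1 by lra.
pose th := Num.min 1 (tau / ((2 + C1) * C1)).
have D0 : 0 < (2 + C1) * C1 by rewrite mulr_gt0//; lra.
have th0 : 0 < th by rewrite lt_min ltr01 divr_gt0.
have [m [_ mP]] := contraction_exponent C0 lam01 th0.
have C1m := strictly_C1_iter m C1g.
have swap := splitting_swap sp.
near (0 : R)^'+ => r.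
(* The crude tolerance 1 suffices: it only has to bound the derivative at [x] on the vector in
   question, and smallness comes from the exponent [m], already fixed. *)
have rP : forall (k l : I) x, fa_dom k x /\ fa_dom l (iter m finv x) ->
    affine_error_le (in_charts (iter m finv) (fa_chart k) (fa_chart l)) (chart_fun (fa_chart k) x)
      (chart_diff (iter m finv) (fa_chart k) (fa_chart l) x) 1 r.
  by near: r; exact: uniform_strict_diff.
have r0 : 0 < r by [].
near=> d => k x y v Lx Ly Kx Ky xy.
have dP : forall (k : I) x, fa_dom k x -> forall y, mdist x y < d ->
    chart_dom (fa_chart k) y /\ `|chart_fun (fa_chart k) x - chart_fun (fa_chart k) y| < r.
  by near: d; exact: uniform_chart_fun.
have gxy : mdist (iter m finv x) (iter m finv y) < fa_radius fa.
  suff H : forall x y, mdist x y < d -> mdist (iter m finv x) (iter m finv y) < fa_radius fa.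
    exact: H.
  by near: d; apply: compact_uniform_continuous => //; [exact: C1m.1|exact: fa_radius_gt0].
have [l lP] := fa_lebesgue fa (iter m finv x).
have Kgx : fa_dom l (iter m finv x) by apply: lP; rewrite mdistxx fa_radius_gt0.
have Kgy := lP _ gxy.
have [_ fxy] := dP k x Kx y xy.
have sdy := C1m.2 _ _ y (fa_atlas k) (fa_atlas l) (fa_sub Ky) (fa_sub Kgy).
have Dxy := affine_error_dist (rP k l x (conj Kx Kgx)) fxy sdy (Q k y v).
have Hy := split_Q_contract sp v Ly Ky Kgy.
have HQx := split_Q_contract sp (Q k y v) Lx Kx Kgx.
have Hs := split_Q_expand (Q k y v) swap C1g C1f gK Lx Kx Kgx.
have [_ u1] := C1P k y v Ly Ky.
have [_ u2] := C1P k x (Q k y v) Lx Kx.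
have H4 := split_PQ sp (Q k y v) Lx Kx.
have H5 := linearD (chart_diff (iter m finv) (fa_chart k) (fa_chart l) x)
   (P k x (Q k y v)) (Q k x (Q k y v)).
have {}H5 := etrans (esym H5) (congr1 (chart_diff (iter m finv) (fa_chart k) (fa_chart l) x) H4).
exact: (small_part_estimate C11 tau0 mP Dxy Hy HQx Hs u1 u2 H5).
Unshelve. all: by end_near. Qed.

(** With subscripts for the base points, [P_x - P_y = P_x Q_y - Q_x P_y]; the first term is small by
    [small_stable_part], the second by its time reversal. *)
Lemma projection_uniformly_continuous f finv Lambda P Q C lambda (C1 tau : R) :
  @chart_splitting R n M S fa f finv Lambda P Q C lambda ->
  strictly_C1 S f -> strictly_C1 S finv -> cancel f finv -> cancel finv f ->
  0 < C -> 0 < lambda < 1 -> 1 <= C1 ->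
  (forall k x v, Lambda x -> fa_dom k x ->
    `|P k x v| <= C1 * `|v| /\ `|Q k x v| <= C1 * `|v|) ->
  0 < tau ->
  \forall d \near (0 : R)^'+, forall k x y v, Lambda x -> Lambda y ->
    fa_dom k x -> fa_dom k y -> mdist x y < d ->
    `|P k x v - P k y v| <= tau * `|v| /\ `|Q k x v - Q k y v| <= tau * `|v|.
Proof.
move=> sp C1f C1g fK gK C0 lam01 C11 C1P tau0.
have tau20 : 0 < tau / 2 by exact: divr_gt0.
have C1P' k x v : Lambda x -> fa_dom k x ->
    `|Q k x v| <= C1 * `|v| /\ `|P k x v| <= C1 * `|v|.
  by move=> Lx Kx; have [] := C1P k x v Lx Kx.
near=> d => k x y v Lx Ly Kx Ky xy.
have H1 : `|P k x (Q k y v)| <= tau / 2 * `|v|.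
  suff H : forall k x y v, Lambda x -> Lambda y ->
    fa_dom k x -> fa_dom k y -> mdist x y < d ->
    `|P k x (Q k y v)| <= tau / 2 * `|v| by exact: H.
  by near: d; exact: (small_stable_part sp C1f C1g fK gK C0 lam01 C11 C1P tau20).
have H2 : `|Q k x (P k y v)| <= tau / 2 * `|v|.
  suff H : forall k x y v, Lambda x -> Lambda y ->
    fa_dom k x -> fa_dom k y -> mdist x y < d ->
    `|Q k x (P k y v)| <= tau / 2 * `|v| by exact: H.
  by near: d; exact: (small_stable_part (splitting_swap sp) C1g C1f gK fK C0 lam01 C11 C1P' tau20).
have E : P k x v - P k y v = P k x (Q k y v) - Q k x (P k y v).
  rewrite -{1}(split_PQ sp v Ly Ky) linearD /= -{2}(split_PQ sp (P k y v) Lx Kx).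
  by rewrite opprD addrACA subrr add0r.
have E' : Q k x v - Q k y v = - (P k x v - P k y v).
  have H : P k x v + Q k x v = P k y v + Q k y v by rewrite !(split_PQ sp).
  by apply/eqP; rewrite opprB subr_eq addrAC eq_sym subr_eq -H addrC.
have : `|P k x v - P k y v| <= tau * `|v|.
  by rewrite E; apply: le_trans (ler_normB _ _) _; lra.
by rewrite E' normrN.
Unshelve. all: by end_near. Qed.

End splitting.

(** * From pseudo-orbits to hyperbolic chains *)

Lemma perturbed_projection_le (R : realType) (V : normedModType R)
    (a b w v : V) (tau K : R) :
  0 <= tau -> tau * K <= 16^-1 -> `|a - b| <= tau * `|w| -> `|w| <= K * `|v| ->
  `|b| <= 16^-1 * `|v| -> `|a| <= 8^-1 * `|v|.
Proof.
move=> tau0 tK ab wv bv; have := ler_normD (a - b) b; rewrite subrK.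
have : tau * `|w| <= tau * (K * `|v|) by rewrite ler_wpM2l.
have : tau * K * `|v| <= 16^-1 * `|v| by rewrite ler_wpM2r.
lra.
Qed.

Section assembly.
Context (R : realType) (n : nat) (M : metricType R)
  (S : smooth_structure R n M) (fa : finite_atlas S) (cM : compact [set: M]).
Local Notation V := 'rV[R]_n.
Local Notation I := 'I_(fa_size fa).
Local Notation ec := (@fa_chart R n M S fa).

(** The 1/8 demanded of a chain is made of 1/16 from the contraction, where dividing by [C1]
    compensates the norm of [P], and 1/16 from moving the base point of the projection from
    [iter N f X] to its neighbour [Y]. *)
Lemma splitting_step f finv Lambda P Q C lambda (N : nat) (C1 tau K : R)
    (k l : I) X Y :
  @chart_splitting R n M S fa f finv Lambda P Q C lambda ->
  (forall k x v, Lambda x -> fa_dom k x ->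
    `|P k x v| <= C1 * `|v| /\ `|Q k x v| <= C1 * `|v|) ->
  0 < C -> 0 < lambda -> 1 <= C1 ->
  C * lambda ^+ N <= 16^-1 / C1 -> 0 <= tau -> tau * K <= 16^-1 ->
  Lambda X -> fa_dom k X -> fa_dom l (iter N f X) ->
  (forall v, `|P l Y v - P l (iter N f X) v| <= tau * `|v|) ->
  (forall v, `|chart_diff (iter N f) (ec k) (ec l) X v| <= K * `|v|) ->
  forall v, `|P l Y (chart_diff (iter N f) (ec k) (ec l) X v)| <= 8^-1 * `|v| /\
    `|chart_diff (iter N f) (ec k) (ec l) X (P k X v)| <= 8^-1 * `|v|.
Proof.
move=> sp C1P C0 l0 C11 NC tau0 tK LX KX KfX PY DK v.
have C10 : 0 < C1 by lra.
have H1 := split_P_contract sp v LX KX KfX.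
have [H2 _] := C1P k X v LX KX.
have bv : `|chart_diff (iter N f) (ec k) (ec l) X (P k X v)| <= 16^-1 * `|v|.
  apply: (le_trans H1); apply: (@le_trans _ _ (16^-1 / C1 * (C1 * `|v|))).
    apply: ler_pM => //; first by rewrite mulr_ge0 ?exprn_ge0// ltW.
  by rewrite mulrA divfK// gt_eqF.
split; last by apply: (le_trans bv); rewrite ler_wpM2r//; lra.
have E := split_P_forward sp v LX KX KfX.
have bv' := eq_ind _ (fun t => is_true (`|t| <= 16^-1 * `|v|)) bv _ (esym E).
exact: (perturbed_projection_le tau0 tK (PY _) (DK v) bv').
Qed.

Context (kx : M -> I)
  (kxP : forall x y, mdist x y < fa_radius fa -> fa_dom (kx x) y).

Lemma kx_dom x : fa_dom (kx x) x.
Proof. by apply: kxP; rewrite mdistxx fa_radius_gt0. Qed.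

Local Notation phi x := (chart_fun (ec (kx x))).
Local Notation psi x := (chart_inv (ec (kx x))).

Lemma transition_center h (eps : R) : 0 < eps ->
  \forall d \near (0 : R)^'+, forall x y, mdist (h x) y < d ->
    `|phi y y - in_charts h (ec (kx x)) (ec (kx y)) (phi x x)| <= eps.
Proof.
move=> eps0; near=> d => x y hxy.
have dP : forall (k : I) x, fa_dom k x -> forall y, mdist x y < d ->
    chart_dom (ec k) y /\ `|chart_fun (ec k) x - chart_fun (ec k) y| < eps.
  by near: d; exact: uniform_chart_fun.
rewrite in_chartsE chart_funK; last exact: fa_sub (kx_dom x).
by apply/ltW; have [] := dP (kx y) y (kx_dom y) (h x) _; rewrite 1?metric_sym.
Unshelve. all: by end_near. Qed.

(** Needed for the chart expressions of [h] and of its inverse to cancel: the image must fall in the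
    chart chosen at [y]. One half of the Lebesgue radius pays for the jump to [y], the other for the
    distance of [w] from the centre. *)
Lemma transition_dom h : continuous h ->
  \forall r \near (0 : R)^'+, forall x y w, mdist (h x) y < r ->
    `|phi x x - w| < r ->
    chart_cod (ec (kx x)) w /\ chart_dom (ec (kx y)) (h (psi x w)).
Proof.
move=> ch; have rho0 := fa_radius_gt0 fa.
have rho20 : 0 < fa_radius fa / 2 by exact: divr_gt0.
near (0 : R)^'+ => s.
have s0 : 0 < s by [].
have sP : forall x y, mdist x y < s -> mdist (h x) (h y) < fa_radius fa / 2.
  by near: s; exact: compact_uniform_continuous.
near=> r => x y w hxy xw.
have rP : forall (k : I) x, fa_dom k x -> forall v, `|chart_fun (ec k) x - v| < r ->
    chart_cod (ec k) v /\ mdist x (chart_inv (ec k) v) < s.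
  by near: r; exact: uniform_chart_inv.
have rrho : r < fa_radius fa / 2 by near: r; exact: nbhs_right_lt.
have [cw xpsi] := rP _ x (kx_dom x) w xw; split=> //.
apply: fa_sub; apply: kxP; have := sP _ _ xpsi.
have := metric_triangle y (h x) (h (psi x w)); rewrite (metric_sym y (h x)).
lra.
Unshelve. all: by end_near. Qed.

Lemma transition_cancel h hinv x y w : cancel h hinv ->
  chart_cod (ec (kx x)) w -> chart_dom (ec (kx y)) (h (psi x w)) ->
  in_charts hinv (ec (kx y)) (ec (kx x)) (in_charts h (ec (kx x)) (ec (kx y)) w) = w.
Proof.
by move=> hK cw dw; rewrite !in_chartsE chart_funK// hK chart_invK.
Qed.

Lemma pseudo_orbit_backward h hinv (Lambda : set M) (eps : R) :
  continuous hinv -> cancel h hinv -> 0 < eps ->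
  \forall d \near (0 : R)^'+, forall x, pseudo_orbit h Lambda d x ->
    forall i, mdist (hinv (x (i + 1))) (x i) < eps.
Proof.
move=> ch hK eps0; near=> d => x xP i.
have dP : forall x y, mdist x y < d -> mdist (hinv x) (hinv y) < eps.
  by near: d; exact: compact_uniform_continuous.
by have [_ /dP] := xP i; rewrite hK metric_sym.
Unshelve. all: by end_near. Qed.

Definition chain_forward (h : M -> M) (x : int -> M) (i : int) : V -> V :=
  in_charts h (ec (kx (x i))) (ec (kx (x (i + 1)))).

Definition chain_backward (hinv : M -> M) (x : int -> M) (i : int) : V -> V :=
  in_charts hinv (ec (kx (x (i + 1)))) (ec (kx (x i))).

(** The contraction fixes [N], hence the bound [K] on derivatives, hence the tolerances [eta] and
    [tau]. Strict differentiability then bounds [r], and continuity of the projections bounds [d].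
    The nested [near] lets both radii be shrunk further by the applications. *)
Lemma chain_of_pseudo_orbit f finv Lambda P Q C lambda :
  @chart_splitting R n M S fa f finv Lambda P Q C lambda ->
  strictly_C1 S f -> strictly_C1 S finv -> cancel f finv -> cancel finv f ->
  0 < C -> 0 < lambda < 1 ->
  exists (N : nat) (C1 K eta : R), [/\ (0 < N)%N, 1 <= C1, 0 <= K &
    \forall r \near (0 : R)^'+, \forall d \near (0 : R)^'+,
    forall x, pseudo_orbit (iter N f) Lambda d x ->
    hyperbolic_chain (chain_forward (iter N f) x) (chain_backward (iter N finv) x)
      (fun i => chart_diff (iter N f) (ec (kx (x i))) (ec (kx (x (i + 1)))) (x i))
      (fun i => chart_diff (iter N finv) (ec (kx (x (i + 1)))) (ec (kx (x i))) (x (i + 1)))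
      (fun i => P (kx (x i)) (x i)) (fun i => Q (kx (x i)) (x i))
      (fun i => phi (x i) (x i)) C1 K eta r].
Proof.
move=> sp C1f C1g fK gK C0 lam01.
have l0 : 0 < lambda by case/andP: lam01.
have [C1 C11 C1P] := splitting_bounded cM sp C1f C1g fK C0 lam01.
have C10 : 0 < C1 by lra.
have C1P' k x v : Lambda x -> fa_dom k x ->
    `|Q k x v| <= C1 * `|v| /\ `|P k x v| <= C1 * `|v|.
  by move=> Lx Kx; have [] := C1P k x v Lx Kx.
have e0 : 0 < 16^-1 / C1 by rewrite divr_gt0.
have [N [N0 NP]] := contraction_exponent C0 lam01 e0.
have C1h := strictly_C1_iter N C1f; have C1h' := strictly_C1_iter N C1g.
have hK := iter_cancel N fK; have hK' := iter_cancel N gK.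
have [B1 B10 B1P] := uniform_chart_diff_bound fa cM C1h.
have [B2 B20 B2P] := uniform_chart_diff_bound fa cM C1h'.
pose K := B1 + B2; have K0 : 0 < K by rewrite addr_gt0.
(* These choices make [C1 * eta] equal to 1/8 and [tau * K] equal to 1/16. *)
pose eta := 8^-1 / C1; have eta0 : 0 < eta by rewrite divr_gt0.
pose tau := 16^-1 / K; have tau0 : 0 < tau by rewrite divr_gt0.
have tK : tau * K <= 16^-1 by rewrite divfK// gt_eqF.
have swap := splitting_swap sp.
exists N, C1, K, eta; split=> //; first exact: ltW.
near=> r.
have r0 : 0 < r by [].
have rF : forall (k l : I) x, fa_dom k x /\ fa_dom l (iter N f x) ->
    affine_error_le (in_charts (iter N f) (ec k) (ec l)) (chart_fun (ec k) x)
      (chart_diff (iter N f) (ec k) (ec l) x) eta r.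
  by near: r; exact: uniform_strict_diff.
have rG : forall (k l : I) x, fa_dom k x /\ fa_dom l (iter N finv x) ->
    affine_error_le (in_charts (iter N finv) (ec k) (ec l)) (chart_fun (ec k) x)
      (chart_diff (iter N finv) (ec k) (ec l) x) eta r.
  by near: r; exact: uniform_strict_diff.
near (0 : R)^'+ => s.
have srho : s < fa_radius fa by near: s; apply: nbhs_right_lt; exact: fa_radius_gt0.
have s0 : 0 < s by [].
have sP : forall k x y v, Lambda x -> Lambda y ->
    fa_dom k x -> fa_dom k y -> mdist x y < s ->
    `|P k x v - P k y v| <= tau * `|v| /\ `|Q k x v - Q k y v| <= tau * `|v|.
  near: s; exact: (projection_uniformly_continuous cM sp C1f C1g fK gK C0 lam01 C11 C1P tau0).
near=> d => x xP.
have ds : d < s by near: d; exact: nbhs_right_lt.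
have back i : mdist (iter N finv (x (i + 1))) (x i) < s.
  suff H : forall x, pseudo_orbit (iter N f) Lambda d x ->
    forall i, mdist (iter N finv (x (i + 1))) (x i) < s by exact: H.
  by near: d; apply: pseudo_orbit_backward => //; exact: C1h'.1.
have L i : Lambda (x i) by have [] := xP i.
have fwd i : mdist (x (i + 1)) (iter N f (x i)) < s.
  by rewrite metric_sym; apply: lt_trans ds; have [] := xP i.
have {}back i : mdist (x i) (iter N finv (x (i + 1))) < s by rewrite metric_sym.
have Kf i : fa_dom (kx (x (i + 1))) (iter N f (x i)).
  by apply: kxP; exact: lt_trans (fwd i) srho.
have Kg i : fa_dom (kx (x i)) (iter N finv (x (i + 1))).
  by apply: kxP; exact: lt_trans (back i) srho.
have AK i v : `|chart_diff (iter N f) (ec (kx (x i))) (ec (kx (x (i + 1)))) (x i) v| <= K * `|v|.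
  by apply: (le_trans (B1P _ _ _ (kx_dom _) (Kf i) v)); rewrite ler_wpM2r// lerDl ltW.
have BK i v : `|chart_diff (iter N finv) (ec (kx (x (i + 1)))) (ec (kx (x i))) (x (i + 1)) v| <= K * `|v|.
  by apply: (le_trans (B2P _ _ _ (kx_dom _) (Kg i) v)); rewrite ler_wpM2r// lerDr ltW.
have stepP i := splitting_step sp C1P C0 l0 C11 NP (ltW tau0) tK (L i) (kx_dom (x i)) (Kf i)
  (fun v => (sP _ _ _ v (L (i + 1)) (split_iter N sp (L i)) (kx_dom _) (Kf i) (fwd i)).1) (AK i).
have stepQ i := splitting_step swap C1P' C0 l0 C11 NP (ltW tau0) tK (L (i + 1))
  (kx_dom (x (i + 1))) (Kg i)
  (fun v => (sP _ _ _ v (L i) (split_iter N swap (L (i + 1))) (kx_dom _) (Kg i) (back i)).2) (BK i).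
split.
- by move=> i; apply: rF; split; [exact: kx_dom|exact: Kf].
- by move=> i; apply: rG; split; [exact: kx_dom|exact: Kg].
- by move=> i v; exact: (split_PQ sp v (L i) (kx_dom _)).
- by move=> i v; exact: (split_PP sp v (L i) (kx_dom _)).
- by move=> i v; exact: (C1P _ _ v (L i) (kx_dom _)).1.
- by move=> i v; exact: (C1P _ _ v (L i) (kx_dom _)).2.
- by move=> i v; exact: (stepP i v).1.
- by move=> i v; exact: (stepQ i v).1.
- by move=> i v; exact: (stepP i v).2.
- by move=> i v; exact: (stepQ i v).2.
- exact: AK.
- exact: BK.
- exact: C11.
- exact: ltW.
- exact: ltW.
- by rewrite /eta mulrC divfK// gt_eqF.
- exact: r0.
Unshelve. all: by end_near. Qed.

End assembly.

(** * Shadowing and expansivity from hyperbolic chains *)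

Section shadowing.
Context (R : realType) (n : nat) (M : metricType R)
  (S : smooth_structure R n M) (fa : finite_atlas S) (cM : compact [set: M]).
Local Notation V := 'rV[R]_n.
Local Notation I := 'I_(fa_size fa).
Local Notation ec := (@fa_chart R n M S fa).
Context (kx : M -> I)
  (kxP : forall x y, mdist x y < fa_radius fa -> fa_dom (kx x) y).
Local Notation phi x := (chart_fun (ec (kx x))).
Local Notation psi x := (chart_inv (ec (kx x))).

Context (h hinv : M -> M) (Lambda : set M)
  (C1h : strictly_C1 S h) (C1g : strictly_C1 S hinv)
  (hK : cancel h hinv) (gK : cancel hinv h)
  (A B P Q : (int -> M) -> int -> {linear V -> V}) (C K eta : R)
  (C1 : 1 <= C) (K0 : 0 <= K)
  (chainP : \forall r \near (0 : R)^'+, \forall d \near (0 : R)^'+,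
    forall x, pseudo_orbit h Lambda d x ->
    hyperbolic_chain (chain_forward kx h x) (chain_backward kx hinv x)
      (A x) (B x) (P x) (Q x) (fun i => phi (x i) (x i)) C K eta r).

(** The accuracy [eps] comes from [r] alone: coordinates within [r] of a centre give points within
    [eps] of it. The size [d] of the jumps only has to bring the initial defects of the chain,
    forward and backward, below [delta]. *)
Lemma shadowing_of_chains : shadowing h Lambda.
Proof.
move=> eps eps0.
near (0 : R)^'+ => r.
have r0 : 0 < r by [].
have rchain : \forall d \near (0 : R)^'+, forall x, pseudo_orbit h Lambda d x ->
    hyperbolic_chain (chain_forward kx h x) (chain_backward kx hinv x)
      (A x) (B x) (P x) (Q x) (fun i => phi (x i) (x i)) C K eta r.
  by near: r.
have rinv : forall (k : I) x, fa_dom k x -> forall v, `|chart_fun (ec k) x - v| < r ->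
    chart_cod (ec k) v /\ mdist x (chart_inv (ec k) v) < eps.
  by near: r; exact: uniform_chart_inv.
have rh : forall x y w, mdist (h x) y < r -> `|phi x x - w| < r ->
    chart_cod (ec (kx x)) w /\ chart_dom (ec (kx y)) (h (psi x w)).
  by near: r; apply: (transition_dom cM kxP); exact: C1h.1.
have rg : forall x y w, mdist (hinv x) y < r -> `|phi x x - w| < r ->
    chart_cod (ec (kx x)) w /\ chart_dom (ec (kx y)) (hinv (psi x w)).
  by near: r; apply: (transition_dom cM kxP); exact: C1g.1.
pose X := 4 * C * (K + 2).
have C0 : 0 < C by apply: lt_le_trans C1.
have X0 : 0 < X by rewrite mulr_gt0 ?mulr_gt0// ltr_wpDl.
(* Chosen for the room required by [chain_orbit]: the quantity to be kept below [r] is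
   [delta * (X + 1)], while [delta * (X + 2)] equals [r]. *)
pose delta := r / (X + 2).
have delta0 : 0 < delta by rewrite divr_gt0//; lra.
have deltaX : delta * (X + 2) = r by rewrite /delta divfK// gt_eqF//; lra.
have rbig : (K + 2) * (4 * C * delta) + delta < r.
  have -> : (K + 2) * (4 * C * delta) = delta * X by rewrite /X; ring.
  lra.
have Cdr : 4 * C * delta < r.
  have : 0 <= (K + 1) * (4 * C * delta).
    have [c0 dl0] := (ltW C0, ltW delta0).
    by apply: mulr_ge0; [exact: addr_ge0|apply: mulr_ge0 => //; exact: mulr_ge0].
  have E : (K + 2) * (4 * C * delta) = (K + 1) * (4 * C * delta) + 4 * C * delta by ring.
  by move: rbig; rewrite E; lra.
near (0 : R)^'+ => d1.
have d10 : 0 < d1 by [].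
have d1r : d1 < r by near: d1; exact: nbhs_right_lt.
have ch : forall x y, mdist (h x) y < d1 ->
    `|phi y y - in_charts h (ec (kx x)) (ec (kx y)) (phi x x)| <= delta.
  by near: d1; exact: transition_center.
have cg : forall x y, mdist (hinv x) y < d1 ->
    `|phi y y - in_charts hinv (ec (kx x)) (ec (kx y)) (phi x x)| <= delta.
  by near: d1; exact: transition_center.
near (0 : R)^'+ => d.
exists d => // x xP.
have dd1 : d < d1 by near: d; exact: nbhs_right_lt.
have fwd i : mdist (h (x i)) (x (i + 1)) < d1 by apply: lt_trans dd1; have [] := xP i.
have back i : mdist (hinv (x (i + 1))) (x i) < d1.
  suff H : forall x, pseudo_orbit h Lambda d x ->
    forall i, mdist (hinv (x (i + 1))) (x i) < d1 by exact: H.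
  by near: d; apply: pseudo_orbit_backward => //; exact: C1g.1.
have H : hyperbolic_chain (chain_forward kx h x) (chain_backward kx hinv x)
      (A x) (B x) (P x) (Q x) (fun i => phi (x i) (x i)) C K eta r.
  suff H : forall x, pseudo_orbit h Lambda d x ->
    hyperbolic_chain (chain_forward kx h x) (chain_backward kx hinv x)
      (A x) (B x) (P x) (Q x) (fun i => phi (x i) (x i)) C K eta r by exact: H.
  by near: d; exact: rchain.
have [||||v vo vc] := chain_orbit H _ _ _ _ rbig.
- by move=> i; exact: ch.
- by move=> i; exact: cg.
- move=> i w ciw; have [cw dw] := rh _ _ _ (lt_trans (fwd i) d1r) ciw.
  exact: transition_cancel.
- move=> i w ciw; have [cw dw] := rg _ _ _ (lt_trans (back i) d1r) ciw.
  exact: transition_cancel.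
have vr i : `|phi (x i) (x i) - v i| < r := le_lt_trans (vc i) Cdr.
exists (fun i => psi (x i) (v i)).
  move=> i /=; rewrite vo /chain_forward in_chartsE chart_funK//.
  by have [] := rh _ _ _ (lt_trans (fwd i) d1r) (vr i).
by move=> i; apply/ltW; have [] := rinv _ _ (kx_dom kxP (x i)) _ (vr i).
Unshelve. all: by end_near. Qed.

(** Read in the charts of the pseudo-orbit, a true orbit near it is a fixed point of [chain_step]
    inside the window: pushing from the past and pulling from the future give the same point, and
    [P + Q] is the identity. Two such orbits are then compared by [chain_expansive]. *)
Lemma expansive_of_chains :
  exists e0 d0 : R, [/\ 0 < e0, 0 < d0 & shadow_expansive h Lambda e0 d0].
Proof.
near (0 : R)^'+ => r.
have r0 : 0 < r by [].
have rchain : \forall d \near (0 : R)^'+, forall x, pseudo_orbit h Lambda d x ->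
    hyperbolic_chain (chain_forward kx h x) (chain_backward kx hinv x)
      (A x) (B x) (P x) (Q x) (fun i => phi (x i) (x i)) C K eta r.
  by near: r.
near (0 : R)^'+ => d0.
have dchain : forall x, pseudo_orbit h Lambda d0 x ->
    hyperbolic_chain (chain_forward kx h x) (chain_backward kx hinv x)
      (A x) (B x) (P x) (Q x) (fun i => phi (x i) (x i)) C K eta r.
  by near: d0; exact: rchain.
near (0 : R)^'+ => s.
have s0 : 0 < s by [].
have srho : s < fa_radius fa by near: s; apply: nbhs_right_lt; exact: fa_radius_gt0.
have sfun : forall (k : I) x, fa_dom k x -> forall y, mdist x y < s ->
    chart_dom (ec k) y /\ `|chart_fun (ec k) x - chart_fun (ec k) y| < r.
  by near: s; exact: uniform_chart_fun.
(* Halving turns the bounds [<= e0] into the strict bounds [< s]. *)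
exists (s / 2), d0; split=> //; first exact: divr_gt0.
move=> eps eps0.
near (0 : R)^'+ => s2.
have s20 : 0 < s2 by [].
have sinv : forall (k : I) x, fa_dom k x -> forall v, `|chart_fun (ec k) x - v| < s2 ->
    chart_cod (ec k) v /\ mdist x (chart_inv (ec k) v) < eps.
  by near: s2; exact: uniform_chart_inv.
have [T TP] := exp2_unbounded (2 * r / s2).
have {}TP : 2 * r / 2 ^+ T < s2.
  by rewrite ltr_pdivrMr ?exprn_gt0// [_ * 2 ^+ T]mulrC -ltr_pdivrMr.
exists T => x y y' xP yo yo' yy'.
have H := dchain x xP.
pose v (y : int -> M) i := phi (x i) (y i).
have close i : `|i| <= T%:Z -> mdist (x i) (y i) < s /\ mdist (x i) (y' i) < s.
  by move=> /yy'[h1 h2]; split; lra.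
have dom (w : int -> M) i : mdist (x i) (w i) < s ->
    chart_dom (ec (kx (x i))) (w i) /\ `|phi (x i) (x i) - v w i| < r.
  exact: sfun (kx_dom kxP (x i)) _.
have step (w : int -> M) i : full_orbit h w ->
    (forall j, `|j| <= T%:Z -> mdist (x j) (w j) < s) -> `|i| < T%:Z ->
    v w i = chain_step (chain_forward kx h x) (chain_backward kx hinv x) (P x) (Q x) (v w) i.
  move=> wo ws iT.
  have [d1 _] := dom w (i - 1) (ws (i - 1) ltac:(clear -iT; lia)).
  have [d2 _] := dom w (i + 1) (ws (i + 1) ltac:(clear -iT; lia)).
  rewrite /chain_step /chain_forward /chain_backward !in_chartsE /v !chart_funK//.
  rewrite -(wo (i - 1)) subrK (wo i) hK.
  by rewrite (chain_PQ H).
have vv' : `|v y 0 - v y' 0| <= 2 * r / 2 ^+ T.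
  apply: (chain_expansive H) => i iT; last first.
    by split; apply: step => // j /close[].
  by have [c1 c2] := close i iT; split; [have [] := dom y i c1|have [] := dom y' i c2].
have [c1 c2] : mdist (x 0) (y 0) < s /\ mdist (x 0) (y' 0) < s by apply: close; rewrite normr0.
(* The chart is the one chosen at [x 0], but the estimate for its inverse is centred at [y 0], which
   lies in the same closed piece. *)
have [_ yy0] := sinv _ _ (kxP (lt_trans c1 srho)) _ (le_lt_trans vv' TP).
have [dy' _] := dom y' 0 c2.
by apply: ltW; move: yy0; rewrite /v chart_funK.
Unshelve. all: by end_near. Qed.

End shadowing.

Theorem corollary3 (R : realType) (n : nat) (M : metricType R)
  (S : smooth_structure R n M) (g : riemannian_metric S)
  (M_compact : compact [set: M]) (f : C1_diffeo S)
  (hf : exists Lambda : set M, hyperbolic_set g f Lambda /\ ~ countable Lambda) :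
  bohr_chaotic f.
Proof.
have [Lambda [hypL ncL]] := hf.
have [fa _] := finite_atlas_exists S M_compact.
have [P [Q [C [lambda [C0 [lam01 sp]]]]]] := chart_splitting_exists fa M_compact hypL.
have C1f := C1_map_strictly_C1 (diffeo_fun_C1 f).
have C1g := C1_map_strictly_C1 (diffeo_inv_C1 f).
have fK := diffeo_funK f; have gK := diffeo_invK f.
have [kx kxP] := choice (fa_lebesgue fa).
have [N [C1 [K [eta [N0 C11 K0 chainP]]]]] :=
  chain_of_pseudo_orbit M_compact kxP sp C1f C1g fK gK C0 lam01.
have C1h := strictly_C1_iter N C1f; have C1h' := strictly_C1_iter N C1g.
have hK := iter_cancel N fK; have hK' := iter_cancel N gK.
have shad := shadowing_of_chains M_compact kxP C1h C1h' hK hK' C11 K0 chainP.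
have [e0 [d0 [e00 d00 expa]]] :=
  expansive_of_chains M_compact kxP hK chainP.
have [L [Y [L0 Yo window zp]]] := shift_coding M_compact hK'
  (fun x => @split_iter _ _ _ _ _ _ _ _ _ _ _ _ N x sp)
  (fun x => @split_iter _ _ _ _ _ _ _ _ _ _ _ _ N x (splitting_swap sp))
  e00 d00 shad expa ncL.
exact: (bohr_chaotic_of_shift_coding M_compact C1f.1 gK fK N0 L0 Yo window zp).
Qed.
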